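(* Let $G$ be an adapted 3,4-angulation of the square, let $\mathcal{L}$ be a 4-GS labeling of $G$, and let $\overrightarrow{A}_o$ and $\overrightarrow{A}_e$ be the corresponding augmented bipolar contractions of $G$. Let $h_o$ be an $\overrightarrow{A}_o$-increasing function, and let $h_e$ be an $\overrightarrow{A}_e$-increasing function. Placing each vertex $v$ of $G$ at coordinates $(h_o(v),h_e(v))\in\mathbb{R}^2$, and drawing each edge of $G$ as a segment, yields a planar straight-line drawing of $G$.
   Context: Planar maps. A planar map is a connected planar graph drawn in the plane without edge crossings, considered up to continuous deformation. The unbounded face is the outer face, the other faces are inner faces; vertices, edges, arcs and corners incident to the outer face are called outer, the others inner. A corner is the sector between two consecutive edges around a vertex; the degree of a face or vertex is its number of corners. An arc is an edge with a chosen direction, from its initial to its terminal vertex. A 3,4-angulation of the square is a planar map whose inner faces have degree 3 or 4 and whose outer face has degree 4 and is incident to 4 distinct vertices, denoted $v_1,v_2,v_3,v_4$ in clockwise order (walking $v_1\to v_2\to v_3\to v_4\to v_1$ one has the inner faces on the right). It is adapted if every simple cycle which is not the contour of a face has length at least 4. 4-GS labelings. The label jump from a corner labeled $i$ to a corner labeled $i'$ is the $\delta\in\{0,1,2,3\}$ with $i+\delta\equiv i'$ mod 4. A 4-GS labeling of $G$ assigns a label in $\{1,2,3,4\}$ to each inner corner such that: (L0) all inner corners incident to $v_i$ have label $i$; (L1) around every inner vertex and every inner face, the sum of label jumps between consecutive corners in clockwise order is 4; (L2) the label jump from a corner to the next corner in clockwise order around an inner face is strictly positive; (L3) if $e$ is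 an inner edge incident to a face $f$ of degree 3, $c,c'$ are the consecutive corners incident to $e$ in clockwise order around $f$, and $v$ is the vertex at $c'$, then the jump $\delta$ from $c$ to $c'$ and the jump $\epsilon$ from $c'$ to the next corner in clockwise order around $v$ satisfy $\delta+\epsilon\ge 2$. In particular every inner face of degree 4 has corners labeled 1,2,3,4 in clockwise order. Orientations. For an inner arc $a$ let $\mathrm{li}(a),\mathrm{ri}(a),\mathrm{rt}(a),\mathrm{lt}(a)$ be the labels of the corners next to $a$: left at the initial vertex, right at the initial vertex, right at the terminal vertex, left at the terminal vertex. Define the oriented subgraphs of $G$ (on all vertices of $G$) $$A_o=\{a\text{ inner arc}\mid \mathrm{li}(a)=1\text{ or }\mathrm{ri}(a)=2\text{ or }\mathrm{rt}(a)=3\text{ or }\mathrm{lt}(a)=4\}\cup\{(v_1,v_4),(v_2,v_3)\},$$ $$A_e=\{a\text{ inner arc}\mid \mathrm{li}(a)=4\text{ or }\mathrm{ri}(a)=1\text{ or }\mathrm{rt}(a)=2\text{ or }\mathrm{lt}(a)=3\}\cup\{(v_1,v_2),(v_4,v_3)\}.$$ (No edge is oriented both ways in $A_o$, nor in $A_e$.) Let $\overline{A_o}$ (resp. $\overline{A_e}$) be the set of edges of $G$ not in the support of $A_o$ (resp. $A_e$). Diagonal arcs. For an inner face $f$ of degree 4 let $u_i$ be the vertex at the corner of $f$ labeled $i$. If $(u_1,u_2)$ and $(u_4,u_3)$ are in $A_o$, then $(u_2,u_4)$ is an odd diagonal arc; if $(u_2,u_1)$ and $(u_3,u_4)$ are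 in $A_o$, then $(u_1,u_3)$ is an odd diagonal arc. If $(u_1,u_4)$ and $(u_2,u_3)$ are in $A_e$, then $(u_4,u_2)$ is an even diagonal arc; if $(u_4,u_1)$ and $(u_3,u_2)$ are in $A_e$, then $(u_1,u_3)$ is an even diagonal arc. The augmented bipolar contraction $\overrightarrow{A}_o$ (resp. $\overrightarrow{A}_e$) is obtained from $A_o$ (resp. $A_e$) by adding all odd (resp. even) diagonal arcs and contracting the edges in $\overline{A_o}$ (resp. $\overline{A_e}$). Increasing functions. With $V$ the vertex set of $G$, a function $h:V\to\mathbb{R}$ is $\overrightarrow{A}_o$-increasing (resp. $\overrightarrow{A}_e$-increasing) if $h(u)=h(v)$ for every edge $\{u,v\}\in\overline{A_o}$ (resp. $\overline{A_e}$), and $h(u)<h(v)$ for every arc $(u,v)$ in $A_o$ (resp. $A_e$) and every odd (resp. even) diagonal arc $(u,v)$. *)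

(* Defs.v *)
From mathcomp Require Import all_boot all_order all_fingroup all_algebra.
From mathcomp Require Import boolp classical_sets reals topology normedtype.

Set Implicit Arguments.
Unset Strict Implicit.
Unset Printing Implicit Defensive.

Import Order.TTheory GRing.Theory Num.Theory.
Import numFieldNormedType.Exports.

Local Open Scope ring_scope.

(** Planar maps are encoded as combinatorial maps of genus 0.  The darts are
    the arcs; [flip a] is [a] with the opposite direction and [cw a] is the arc
    following [a] in clockwise order among the arcs with the same initial
    vertex.  A corner is represented by the arc [c] such that it is the sector
    between [c] and [cw c], i.e. the corner on the right of [c] at the initial
    vertex of [c].  The only map without such an encoding is the one consisting
    of a single vertex and no edge. *)

Definition turn (D : finType) (flip cw : {perm D}) : {perm D} :=
  (flip * cw^-1)%g.

Record planar_map := PlanarMap {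
  arc :> finType;
  flip : {perm arc};
  cw : {perm arc};
  flip_involutive : involutive flip;
  flip_neq : forall a, flip a != a;
  map_connected :
    forall a b, connect (fun x y => (y == flip x) || (y == cw x)) a b;
  map_euler :
    (#|porbits cw| + #|porbits (turn flip cw)| = #|porbits flip| + 2)%N
}.

Section Maps.

Variable G : planar_map.
Implicit Types (a b c : G).

(** [face_next a] follows [a] on the contour of the face on the right of [a].  As a
    map on corners, [face_next c] follows [c] in clockwise order around an inner
    face, while [cw c] follows [c] in clockwise order around a vertex. *)
Definition face_next : {perm G} := turn (flip G) (cw G).

Definition face c : {set G} := porbit face_next c.
Definition face_degree c : nat := #|face c|.

Definition vertex : Type := {v : {set G} | v \in porbits (cw G)}.

Definition init_vertex a : vertex :=
  exist _ (porbit (cw G) a) (imset_f (porbit (cw G)) (isT : a \in G)).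
Definition term_vertex a : vertex := init_vertex (flip G a).

(** The last condition prevents an edge traversed back and forth from being a
    cycle of length 2. *)
Definition simple_cycle (s : seq G) : bool :=
  [&& s != [::], path.cycle (fun a b => term_vertex a == init_vertex b) s,
      uniq (map init_vertex s) & all (fun a => flip G a \notin s) s].

Definition face_contour (s : seq G) : bool :=
  fcycle face_next s || fcycle face_next (rev (map (flip G) s)).

Definition adapted : Prop :=
  forall s : seq G, simple_cycle s -> ~~ face_contour s -> (4 <= size s)%N.

(** From here on, the outer face is the face on the right of the arc [r]. *)
Variable r : G.

Definition outer_corner c : bool := c \in face r.
Definition inner_corner c : bool := ~~ outer_corner c.
Definition inner_arc a : bool :=
  ~~ outer_corner a && ~~ outer_corner (flip G a).
Definition inner_vertex (v : vertex) : Prop :=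
  forall c, init_vertex c = v -> inner_corner c.

Definition angulation34_of_square : Prop :=
  [/\ face_degree r = 4%N,
      {in face r &, injective init_vertex} &
      forall c, inner_corner c -> face_degree c = 3%N \/ face_degree c = 4%N].

(** [r] goes from v_1 to v_4: the walk having the outer face on its right is
    v_1 -> v_4 -> v_3 -> v_2 -> v_1.  Below, [outer_arc i] is the arc of this
    walk starting at v_i. *)
Definition outer_arc (i : nat) : G := iter ((5 - i) %% 4) face_next r.

Definition sq_vertex (i : nat) : vertex := init_vertex (outer_arc i).

Variable L : G -> nat.

(** For labels [i] and [j] in {1,2,3,4}, this is the element of {0,1,2,3}
    congruent to [j - i] modulo 4. *)
Definition jump (i j : nat) : nat := ((j + 4) - i) %% 4.

(** The values of [L] at the outer corners are irrelevant. *)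
Record GS4_labeling : Prop := {
  GS4_range : forall c, inner_corner c -> (1 <= L c <= 4)%N;
  GS4_L0 : forall (i : nat) c, (1 <= i <= 4)%N ->
    inner_corner c -> init_vertex c = sq_vertex i -> L c = i;
  GS4_L1_vertex : forall c, inner_vertex (init_vertex c) ->
    (\sum_(x in porbit (cw G) c) jump (L x) (L (cw G x)) = 4)%N;
  GS4_L1_face : forall c, inner_corner c ->
    (\sum_(x in face c) jump (L x) (L (face_next x)) = 4)%N;
  GS4_L2 : forall c, inner_corner c -> (0 < jump (L c) (L (face_next c)))%N;
  GS4_L3 : forall c, inner_arc c -> face_degree c = 3%N ->
    (2 <= jump (L c) (L (face_next c))
        + jump (L (face_next c)) (L (cw G (face_next c))))%N
}.

Definition ri_label a : nat := L a.
Definition li_label a : nat := L ((cw G)^-1%g a).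
Definition rt_label a : nat := li_label (flip G a).
Definition lt_label a : nat := ri_label (flip G a).

Definition A_odd a : bool :=
  inner_arc a && [|| li_label a == 1%N, ri_label a == 2%N, rt_label a == 3%N | lt_label a == 4%N]
  || (a == outer_arc 1) || (a == flip G (outer_arc 3)).

Definition A_even a : bool :=
  inner_arc a && [|| li_label a == 4%N, ri_label a == 1%N, rt_label a == 2%N | lt_label a == 3%N]
  || (a == flip G (outer_arc 2)) || (a == outer_arc 4).

(** [c1] is the corner labeled 1 of an inner face of degree 4 whose corners
    labeled 1, 2, 3, 4 are [c1], [face_next c1], [face_next (face_next c1)] and
    [face_next (face_next (face_next c1))]; the latter, seen as arcs, are (u_1,u_2),
    (u_2,u_3), (u_3,u_4), (u_4,u_1). *)
Definition quad_corner1 c1 : Prop :=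
  [/\ inner_corner c1, face_degree c1 = 4%N & L c1 = 1%N].

Definition odd_diagonal (u v : vertex) : Prop :=
  exists2 c1, quad_corner1 c1 &
    let c2 := face_next c1 in let c3 := face_next c2 in let c4 := face_next c3 in
    [/\ A_odd c1, A_odd (flip G c3), u = init_vertex c2 & v = init_vertex c4]
    \/ [/\ A_odd (flip G c1), A_odd c3, u = init_vertex c1 & v = init_vertex c3].

Definition even_diagonal (u v : vertex) : Prop :=
  exists2 c1, quad_corner1 c1 &
    let c2 := face_next c1 in let c3 := face_next c2 in let c4 := face_next c3 in
    [/\ A_even (flip G c4), A_even c2, u = init_vertex c4 & v = init_vertex c2]
    \/ [/\ A_even c4, A_even (flip G c2), u = init_vertex c1 & v = init_vertex c3].

Definition increasing_for (R : realType) (A : G -> bool)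
    (diagonal : vertex -> vertex -> Prop) (h : vertex -> R) : Prop :=
  [/\ forall a, ~~ A a -> ~~ A (flip G a) -> h (init_vertex a) = h (term_vertex a),
      forall a, A a -> h (init_vertex a) < h (term_vertex a) &
      forall u v, diagonal u v -> h u < h v].

Definition odd_increasing (R : realType) (h : vertex -> R) : Prop :=
  increasing_for A_odd odd_diagonal h.

Definition even_increasing (R : realType) (h : vertex -> R) : Prop :=
  increasing_for A_even even_diagonal h.

End Maps.

Section Drawings.

Local Open Scope classical_set_scope.

Variables (R : realType) (G : planar_map) (r : G).
Variable pos : vertex G -> R * R.

Definition segment (p q : R * R) : set (R * R) :=
  [set x | exists2 t : R, 0 <= t <= 1 &
     x = ((1 - t) * p.1 + t * q.1, (1 - t) * p.2 + t * q.2)].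

Definition open_segment (p q : R * R) : set (R * R) :=
  [set x | exists2 t : R, 0 < t < 1 &
     x = ((1 - t) * p.1 + t * q.1, (1 - t) * p.2 + t * q.2)].

Definition vector_of (a : G) : R * R :=
  ((pos (term_vertex a)).1 - (pos (init_vertex a)).1, (pos (term_vertex a)).2 - (pos (init_vertex a)).2).

Definition cross (u v : R * R) : R := u.1 * v.2 - u.2 * v.1.

(** For vectors with three distinct directions, the clockwise angles from [u]
    to [v], from [v] to [w] and from [w] to [u] add up to 2 pi if [u, v, w]
    appear in clockwise order, and to 4 pi otherwise; so the order is clockwise
    exactly when at least two of these angles are less than pi. *)
Definition clockwise (u v w : R * R) : bool :=
  [|| (cross u v < 0) && (cross v w < 0),
      (cross v w < 0) && (cross w u < 0) |
      (cross w u < 0) && (cross u v < 0)].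

Definition drawing_support : set (R * R) :=
  \bigcup_(a in [set: G]) segment (pos (init_vertex a)) (pos (term_vertex a)).

Definition right_of (a : G) (e : R) : R * R :=
  let p := pos (init_vertex a) in let q := pos (term_vertex a) in let u := vector_of a in
  ((p.1 + q.1) / 2 + e * u.2, (p.2 + q.2) / 2 - e * u.1).

(** As [G] is a planar map, i.e. a graph embedded up to deformation, a drawing
    of [G] is required to realize this embedding: besides having no crossings,
    it has the clockwise order of the arcs around each vertex and the outer
    face prescribed by [G]. *)
Record planar_straight_line_drawing : Prop := {
  drawing_vertices : injective pos;
  drawing_vertex_edge : forall (v : vertex G) (a : G),
    ~ open_segment (pos (init_vertex a)) (pos (term_vertex a)) (pos v);
  drawing_edge_edge : forall a b : G, b != a -> b != flip G a ->
    open_segment (pos (init_vertex a)) (pos (term_vertex a)) `&`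
    open_segment (pos (init_vertex b)) (pos (term_vertex b)) = set0;
  drawing_rotation : forall a b : G, init_vertex b = init_vertex a ->
    b != a -> b != cw G a ->
    clockwise (vector_of a) (vector_of (cw G a)) (vector_of b);
  drawing_outer_face : forall a : G, outer_corner r a ->
    \forall e \near 0^'+,
      ~ bounded_set (connected_component (~` drawing_support) (right_of a e))
}.

End Drawings.

(* Main.v *)
Require Import Defs.
From mathcomp Require Import all_boot all_order all_fingroup all_algebra.
From mathcomp Require Import boolp classical_sets reals topology normedtype.
From mathcomp Require Import zify ring lra.

(** Double counting with Euler's formula shows that the label jumps around each inner
    edge add up to 4.  Hence every arc points toward one or two consecutive of the
    directions up, right, down, left, and the labels next to it tell which ones.  It
    follows that an inner triangle is drawn clockwise, and, thanks to the diagonal arcs,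
    that in an inner quadrangle the vertices labeled 1 and 2 are strictly to the left of
    those labeled 3 and 4, and the vertices labeled 1 and 4 strictly below those labeled
    2 and 3.

    So a vertical line, shifted infinitesimally to avoid the vertices, meets the boundary
    of an inner face at most twice, at a lower and an upper arc.  As each inner edge is the
    upper arc of one face and the lower arc of another, a telescoping sum shows that the
    intervals cut by the inner faces on the shifted line are pairwise disjoint.  A crossing,
    or a vertex lying on another vertex or on an edge, would make two of them overlap.

    For the rotation, the directions of the arcs around a vertex are counted in eighths
    of a turn: from an arc to the next one, the count never decreases, and the sum of the
    label jumps shows that a tour around the vertex is exactly one turn. *)

Set Implicit Arguments.
Unset Strict Implicit.
Unset Printing Implicit Defensive.

(** That each inner face is well drawn is a local fact and does not prevent two faces from
    overlapping. The global information comes from the outer contour alone: it is an axis-parallel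
    rectangle, so a vertical line meets it in at most one lower and one upper arc, and after
    cancellation at most one inner face can contain a given place of the line. This takes the place
    of a Jordan curve argument.

    An arc counts as crossed when the abscissa lies in a half-open interval, so a vertical arc is
    never crossed. Vertical arcs are caught through the inner face on their right, whose
    neighbouring arcs leave their two ends to the right.

    The separation of the vertices of a quadrangle in both coordinates does not make it convex. It
    does bound the crossings of a vertical line, and it forces clockwise turns at a strictly
    leftmost or rightmost vertex. *)

Lemma sum_porbits (T : finType) (s : {perm T}) (F : T -> nat) :
  \sum_x F x = \sum_(A in porbits s) \sum_(x in A) F x.
Proof.
rewrite (partition_big (porbit s) (mem (porbits s))) /=; last first.
  by move=> x _; apply: imset_f.
apply: eq_bigr => A /imsetP[y _ ->].
by apply: eq_bigl => x; rewrite eq_porbit_mem.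
Qed.

Lemma porbit_step (T : finType) (s : {perm T}) x : porbit s (s x) = porbit s x.
Proof. by have := porbit_perm s 1 x; rewrite expg1. Qed.

Lemma mem_porbit_step (T : finType) (s : {perm T}) x y :
  (s x \in porbit s y) = (x \in porbit s y).
Proof. by rewrite -!eq_porbit_mem porbit_step. Qed.

(** * Arcs, vertices and faces of a combinatorial map *)

Section Basics.

Variable G : planar_map.
Implicit Types a b c : G.

Lemma flipK a : flip G (flip G a) = a.
Proof. exact: flip_involutive. Qed.

Lemma cw_face_next a : cw G (face_next G a) = flip G a.
Proof. by rewrite /face_next /turn permM permKV. Qed.

Lemma face_next_flip a : face_next G (flip G a) = (cw G)^-1%g a.
Proof. by rewrite /face_next /turn permM flipK. Qed.

Lemma face_next_flip_cw a : face_next G (flip G (cw G a)) = a.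
Proof. by rewrite face_next_flip permK. Qed.

Lemma eq_init_vertex a b :
  (init_vertex a == init_vertex b) = (porbit (cw G) a == porbit (cw G) b).
Proof. by rewrite -val_eqE. Qed.

Lemma init_vertexP a b :
  init_vertex a = init_vertex b <-> a \in porbit (cw G) b.
Proof.
rewrite -eq_porbit_mem; split=> [/eqP|/eqP] H; first by rewrite -eq_init_vertex.
by apply/eqP; rewrite eq_init_vertex; apply/eqP.
Qed.

Lemma init_vertex_cw a : init_vertex (cw G a) = init_vertex a.
Proof. by apply/init_vertexP; rewrite mem_porbit_step porbit_id. Qed.

Lemma init_face_next a : init_vertex (face_next G a) = term_vertex a.
Proof. by rewrite -init_vertex_cw cw_face_next. Qed.

Lemma term_flip a : term_vertex (flip G a) = init_vertex a.
Proof. by rewrite /term_vertex flipK. Qed.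

Lemma vertex_init (v : vertex G) : exists a, v = init_vertex a.
Proof.
case: v => A HA; case/imsetP: (HA) => a _ Aa; exists a.
by apply: val_inj => /=.
Qed.

Lemma mem_face_next c b : (face_next G c \in face b) = (c \in face b).
Proof. exact: mem_porbit_step. Qed.

Lemma face_eq c b : c \in face b -> face c = face b.
Proof. by rewrite -eq_porbit_mem => /eqP. Qed.

Lemma iter_face c : iter (face_degree c) (face_next G) c = c.
Proof. exact: iter_porbit. Qed.

Lemma face_uniq c : uniq (traject (face_next G) c (face_degree c)).
Proof. exact: uniq_traject_porbit. Qed.

Lemma face_mem c : face c =i traject (face_next G) c (face_degree c).
Proof. exact: porbit_traject. Qed.

Lemma big_face (V : Type) (idx : V) (op : Monoid.com_law idx) (F : G -> V) c :
  \big[op/idx]_(x in face c) F x =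
  \big[op/idx]_(x <- traject (face_next G) c (face_degree c)) F x.
Proof.
by rewrite (eq_bigl _ _ (face_mem c)) big_uniq // face_uniq.
Qed.

Lemma card_porbits_flip : (#|porbits (flip G)| * 2)%N = #|G|.
Proof.
rewrite -sum_nat_const -sum1_card (sum_porbits (flip G) (fun=> 1)).
apply: eq_bigr => A /imsetP[a _ ->].
have flip_pair : porbit (flip G) a = [set a; flip G a].
  apply/setP => b; rewrite !inE; apply/porbitP/orP => [[i ->]|[] /eqP->].
  - elim: i => [|i]; first by left; rewrite expg0 perm1.
    rewrite expgSr permM => -[] /eqP->; first by right.
    by left; rewrite flipK.
  - by exists 0; rewrite expg0 perm1.
  - by exists 1; rewrite expg1.
by rewrite sum1_card flip_pair cards2 eq_sym flip_neq.
Qed.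

End Basics.

(** * Label jumps around an edge *)

Section Labels.

Variables (G : planar_map) (r : G) (L : G -> nat).
Hypothesis G34 : angulation34_of_square r.
Implicit Types a b c : G.

Lemma inner_face_next c : inner_corner r (face_next G c) = inner_corner r c.
Proof. by rewrite /inner_corner /outer_corner mem_face_next. Qed.

Lemma inner_corner_face c b :
  c \in face b -> inner_corner r c = inner_corner r b.
Proof.
by move=> cb; rewrite /inner_corner /outer_corner ![_ \in face r]porbit_sym -/(face c)
  (face_eq cb).
Qed.

Lemma outer_face_next4 : face_next G (outer_arc r 2) = r.
Proof. by have := iter_face r; case: G34 => -> _ _. Qed.

Lemma outer_mem a : (a \in face r) =
  [|| a == outer_arc r 1, a == outer_arc r 4, a == outer_arc r 3 | a == outer_arc r 2].
Proof. by rewrite face_mem; case: G34 => -> _ _; rewrite !inE. Qed.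

Lemma outer_uniq :
  uniq [:: outer_arc r 1; outer_arc r 4; outer_arc r 3; outer_arc r 2].
Proof. by have := face_uniq r; case: G34 => -> _ _. Qed.

Lemma outer_arc_mem i : outer_arc r i \in face r.
Proof.
rewrite /outer_arc; elim: ((5 - i) %% 4) => [|n IH] /=; first exact: porbit_id.
by rewrite mem_face_next.
Qed.

Lemma outer_arc_pred i : 1 <= i <= 4 ->
  face_next G (outer_arc r i) = outer_arc r (if i == 1 then 4 else i.-1).
Proof. by case: i => [|[|[|[|[|i]]]]] //= _; rewrite outer_face_next4. Qed.

Lemma flip_outer_inner a : a \in face r -> flip G a \notin face r.
Proof.
case: G34 => deg4 inj _ ar; apply/negP => far.
have nar : face_next G a \in face r by rewrite mem_face_next.
have e1 : flip G a = face_next G a by apply: inj; rewrite // init_face_next.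
have e2 : face_next G (flip G a) = a.
  by apply: inj; rewrite ?mem_face_next // init_face_next term_flip.
have := iter_face a; have := face_uniq a.
have -> : face_degree a = 4 by rewrite -deg4 /face_degree (face_eq ar).
by rewrite /= -e1 e2 !inE eqxx !orbT.
Qed.

Lemma inner_arcE a : inner_arc r a = inner_corner r a && inner_corner r (flip G a).
Proof. by []. Qed.

Lemma outer_arc_exists a : a \in face r ->
  exists2 i, 1 <= i <= 4 & a = outer_arc r i.
Proof.
by rewrite outer_mem => /or4P[] /eqP->; [exists 1|exists 4|exists 3|exists 2].
Qed.

Hypothesis Lab : GS4_labeling r L.

Let jf c := jump (L c) (L (face_next G c)).
Let jv c := jump (L c) (L (cw G c)).

Lemma label_flip_outer i : 1 <= i <= 4 ->
  L (flip G (outer_arc r i)) = (if i == 1 then 4 else i.-1) /\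
  L (face_next G (flip G (outer_arc r i))) = i.
Proof.
move=> i14; have inn := flip_outer_inner (outer_arc_mem i).
split; apply: (GS4_L0 Lab).
- by case: i i14 {inn} => [|[|[|[|[|i]]]]].
- exact: inn.
- by rewrite /sq_vertex -outer_arc_pred // init_face_next.
- by [].
- by rewrite inner_face_next; exact: inn.
- by rewrite init_face_next term_flip.
Qed.

Lemma jf_flip_outer a : a \in face r -> jf (flip G a) = 1.
Proof.
case/outer_arc_exists => i i14 ->; rewrite /jf.
by have [-> ->] := label_flip_outer i14; case: i i14 => [|[|[|[|[|i]]]]].
Qed.

Lemma label_outer_vertex a c : a \in face r -> init_vertex c = init_vertex a ->
  inner_corner r c -> exists2 i, 1 <= i <= 4 & a = outer_arc r i /\ L c = i.
Proof.
move=> /outer_arc_exists[i i14 ->] ca inn; exists i => //; split=> //.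
exact: (GS4_L0 Lab).
Qed.

Lemma sum_jf : \sum_(a | inner_corner r a) jf a = 4 * (#|porbits (face_next G)| - 1).
Proof.
rewrite big_mkcond (sum_porbits (face_next G)) /=.
rewrite (bigD1 (face r)) /=; last exact: imset_f.
rewrite [X in X + _]big1 ?add0n => [|a ar]; last first.
  by rewrite /inner_corner /outer_corner ar.
rewrite (eq_bigr (fun _ => 4)) => [|A /andP[/imsetP[a _ ->] far]]; last first.
  have inn : inner_corner r a.
    by rewrite /inner_corner /outer_corner -eq_porbit_mem.
  rewrite -(GS4_L1_face Lab inn); apply: eq_bigr => x xa.
  by rewrite (inner_corner_face xa) inn.
rewrite sum_nat_const mulnC; congr (_ * _).
rewrite [in RHS](cardD1 (face r)).
rewrite (imset_f (porbit (face_next G)) (isT : r \in predT)) add1n subn1 /=.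
by apply: eq_card => A; rewrite !inE andbC.
Qed.

(** The term 16 stands for the four outer vertices: by L0 the inner corners of each carry a single
    label, so each contributes 0 instead of 4. *)
Lemma sum_jv :
  \sum_(c | inner_corner r c && inner_corner r (cw G c)) jv c + 16 =
  4 * #|porbits (cw G)|.
Proof.
rewrite big_mkcond (sum_porbits (cw G)) /=.
pose O := [set porbit (cw G) a | a in face r].
have cardO : #|O| = 4.
  case: G34 => <- inj _; apply: card_in_imset => a b ar br ab.
  by apply: inj => //; apply/eqP; rewrite eq_init_vertex ab.
have subO : O \subset porbits (cw G) by apply: imsetS; exact: subset_predT.
rewrite (big_setID O) /= (finset.setIidPr subO) big1 ?add0n => [|A /imsetP[a ar ->]].
  rewrite (eq_bigr (fun _ => 4)) => [|A]; last first.
    rewrite inE => /andP[AO /imsetP[a _ Aa]]; move: AO; rewrite {A}Aa => AO.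
    have inn c : c \in porbit (cw G) a -> inner_corner r c.
      rewrite -eq_porbit_mem => /eqP ca; apply: contra AO => cr.
      by rewrite -ca; apply: imset_f.
    rewrite -(GS4_L1_vertex Lab (c := a)) => [|c /init_vertexP]; last exact: inn.
    by apply: eq_bigr => c ca; rewrite !inn // mem_porbit_step.
  rewrite sum_nat_const -(cardsID O (porbits (cw G))) (finset.setIidPr subO) cardO.
  lia.
apply: big1 => c /init_vertexP ca; case: ifP => // /andP[ic icw].
have [i i14 [ai Li]] := label_outer_vertex ar ca ic.
have := label_outer_vertex ar (etrans (init_vertex_cw c) ca) icw.
case=> j j14 [aj Lj].
rewrite /jv Li Lj (_ : i = j).
  by case: j {aj Lj} j14 => [|[|[|[|[|j]]]]].
rewrite -Li; apply: (GS4_L0 Lab) => //; by rewrite ca aj.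
Qed.

Let edge_sum a := jf a + jv (face_next G a) + jf (flip G a) + jv (face_next G (flip G a)).

Lemma card_inner_arc : #|[pred a | inner_arc r a]| + 8 = #|G|.
Proof.
have deg4 : #|face r| = 4 by case: G34.
pose O := face r :|: [set flip G a | a in face r].
have memO a : (a \in O) = ~~ inner_arc r a.
  rewrite inE /inner_arc /outer_corner -negb_or negbK; congr (_ || _).
  by rewrite -{1}(flipK a) mem_imset //; apply: perm_inj.
have cardO : #|O| = 8.
  rewrite cardsU (_ : _ :&: _ = finset.set0) ?cards0 ?subn0.
    by rewrite card_imset ?deg4 //; apply: perm_inj.
  apply/setP => a; rewrite !inE; apply/negP => /andP[ar /imsetP[b br ab]].
  by have := flip_outer_inner br; rewrite -ab ar.
rewrite -(cardC [pred a | inner_arc r a]) -cardO; congr (_ + _).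
by apply: eq_card => a; rewrite memO !inE.
Qed.

(** With V, E, F the numbers of vertices, edges and faces, the face jumps amount to 4(F - 1) - 4 and
    the vertex jumps to 4V - 16. Each is counted for both directions of an edge, and Euler's formula
    turns the total into 4(2E - 8). *)
Lemma sum_edge_sum :
  \sum_(a | inner_arc r a) edge_sum a = 4 * #|[pred a | inner_arc r a]|.
Proof.
have flip_sum (F : G -> nat) :
    \sum_(a | inner_arc r a) F (flip G a) = \sum_(a | inner_arc r a) F a.
  rewrite (reindex_inj (@perm_inj _ (flip G))) /=; apply: eq_big => a.
    by rewrite !inner_arcE flipK andbC.
  by rewrite flipK.
rewrite /edge_sum !big_split /= (flip_sum jf) -(flip_sum (fun a => jv (face_next G a))).
have e1 : \sum_(a | inner_arc r a) jf a + 4 = \sum_(a | inner_corner r a) jf a.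
  rewrite [RHS](bigID (fun a => inner_corner r (flip G a))) /=; congr (_ + _).
  rewrite (eq_bigl [in [set flip G a | a in face r]]) => [|a]; last first.
    rewrite -{3}(flipK a) mem_imset ?negbK; last exact: perm_inj.
    apply/andP/idP => [[]|far]; rewrite /inner_corner /outer_corner ?negbK //.
    by have := flip_outer_inner far; rewrite flipK.
  rewrite (eq_bigr (fun _ => 1)) => [|a /imsetP[b br ->]]; last exact: jf_flip_outer.
  by rewrite sum1_card card_imset; [case: G34 => <-|apply: perm_inj].
have e2 : \sum_(a | inner_arc r a) jv (face_next G (flip G a)) =
   \sum_(c | inner_corner r c && inner_corner r (cw G c)) jv c.
  rewrite [LHS](reindex_inj (@perm_inj _ (cw G))) /=; apply: eq_big => a.
    rewrite inner_arcE andbC -[inner_corner r (flip G _)]inner_face_next.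
    by rewrite face_next_flip_cw.
  by rewrite face_next_flip_cw.
have := sum_jf; have := sum_jv; have := map_euler G; have := card_inner_arc.
have := card_porbits_flip G; rewrite e2 -/(face_next G) -e1.
have : 0 < #|porbits (face_next G)|.
  by apply/card_gt0P; exists (face r); apply: imset_f.
lia.
Qed.

(** The four jumps close up modulo 4, so their sum is a multiple of 4, and it is positive by L2.
    Being at least 4 on every inner edge and 4 on average, it is 4 everywhere. *)
Lemma edge_label_sum a : inner_arc r a ->
  jump (L a) (L (face_next G a)) + jump (L (face_next G a)) (L (flip G a)) +
  jump (L (flip G a)) (L (face_next G (flip G a))) +
  jump (L (face_next G (flip G a))) (L a) = 4.
Proof.
move=> ia.
have esE b : edge_sum b = jump (L b) (L (face_next G b)) + jump (L (face_next G b)) (L (flip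
  G b)) +
  jump (L (flip G b)) (L (face_next G (flip G b))) +
  jump (L (face_next G (flip G b))) (L b).
  by rewrite /edge_sum /jf /jv !cw_face_next flipK.
rewrite -esE.
have es4 b : inner_arc r b -> 4 <= edge_sum b.
  move=> /andP[ib ifb]; rewrite esE.
  have := GS4_L2 Lab ib.
  have := GS4_range Lab ib; have := GS4_range Lab ifb.
  have := GS4_range Lab (c := face_next G b); rewrite inner_face_next => /(_ ib).
  have := GS4_range Lab (c := face_next G (flip G b)); rewrite inner_face_next => /(_ ifb).
  rewrite /jump; lia.
have : \sum_(b | inner_arc r b) (edge_sum b - 4) == 0.
  rewrite sumnB; last exact: es4.
  by rewrite sum_edge_sum sum_nat_const mulnC subnn.
rewrite sum_nat_eq0 => /forallP/(_ a); rewrite ia /= => /eqP.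
by have := es4 _ ia; lia.
Qed.

End Labels.

(** * Directions of the arcs *)

(** The labels [ri rt lt li] are those of the corners met when turning clockwise
    around an edge; [tR] and [tL] tell whether the faces on its right and on its left
    are triangles. *)
Definition edge_ok (tR tL : bool) (ri rt lt li : nat) :=
  [&& jump ri rt + jump rt lt + jump lt li + jump li ri == 4,
      0 < jump ri rt <= 2, 0 < jump lt li <= 2,
      if tR then 2 <= jump ri rt + jump rt lt else jump ri rt == 1 &
      if tL then 2 <= jump lt li + jump li ri else jump lt li == 1].

(** A single form for the conditions of [A_odd], [A_even] and their reversals: with the directions
    numbered clockwise from up, a quarter turn adds 1 to every label. *)
Definition toward_labels (ri rt lt li i : nat) :=
  [|| li == i %[mod 4], ri == i + 1 %[mod 4], rt == i + 2 %[mod 4]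
    | lt == i + 3 %[mod 4]].

(** What the face on the right knows of an arc. Seen from [ri], the arc points toward [ri + 3],
    possibly together with one adjacent direction; [rt] gives the analogous constraint, and a
    triangle excludes one more direction. *)
Definition right_spec (tri : bool) (d ri rt : nat) (t : nat -> bool) :=
  [&& t (ri + 3), ~~ t (ri + 1), ~~ (t ri && t (ri + 2)),
      t (rt + 2), ~~ t rt, ~~ (t (rt + 1) && t (rt + 3)),
      tri ==> ~~ t (ri + 2) & tri ==> (d == 2) ==> t ri].

(** Both sides locate the arc in eighths of a turn, once from the label on its right and once from
    the label on its left. The subtractions are never truncated. *)
Definition jump_spec ri li (t : nat -> bool) :=
  (jump li ri <= 2) && (2 * jump li ri + (1 + t ri - t ri.+2) == 2 + (1 + t li.+1 - t li.+3)).

Lemma edge_okP tR tL ri rt lt li :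
  1 <= ri <= 4 -> 1 <= rt <= 4 -> 1 <= lt <= 4 -> 1 <= li <= 4 ->
  edge_ok tR tL ri rt lt li ->
  right_spec tR (jump ri rt) ri rt (toward_labels ri rt lt li) &&
  jump_spec ri li (toward_labels ri rt lt li).
Proof.
(* The labels range over 1, ..., 4, which leaves 256 quadruples to check by computation for each
   choice of [tR] and [tL]. *)
have : all (fun p => edge_ok tR tL p.1.1 p.1.2 p.2.1 p.2.2 ==>
         right_spec tR (jump p.1.1 p.1.2) p.1.1 p.1.2 (toward_labels p.1.1 p.1.2 p.2.1 p.2.2) &&
         jump_spec p.1.1 p.2.2 (toward_labels p.1.1 p.1.2 p.2.1 p.2.2))
   [seq (p, q) | p <- [seq (i, j) | i <- iota 1 4, j <- iota 1 4],
                 q <- [seq (i, j) | i <- iota 1 4, j <- iota 1 4]].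
  by case: tR; case: tL; vm_compute.
move=> /allP ok h1 h2 h3 h4; apply/implyP; apply: (ok ((ri, rt), (lt, li))).
by rewrite !allpairs_f ?mem_iota.
Qed.

Section ArcDirections.

Variables (G : planar_map) (r : G) (L : G -> nat).
Implicit Types a b c : G.

(** The directions are numbered clockwise modulo 4: up, right, down, left. *)
Definition toward a (i : nat) : bool :=
  match i %% 4 with
  | 0 => A_even r L a
  | 1 => A_odd r L a
  | 2 => A_even r L (flip G a)
  | _ => A_odd r L (flip G a)
  end.

Lemma toward_mod a i j : i = j %[mod 4] -> toward a i = toward a j.
Proof. by rewrite /toward => ->. Qed.

Lemma toward_flip a i : toward (flip G a) i = toward a (i + 2).
Proof.
rewrite /toward flipK -(modnDml i 2); have := ltn_pmod i (isT : 0 < 4).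
by case: (i %% 4) => [|[|[|[|]]]].
Qed.

Hypothesis G34 : angulation34_of_square r.
Hypothesis Lab : GS4_labeling r L.

Lemma label_range c : inner_corner r c -> 1 <= L c <= 4.
Proof. exact: (GS4_range Lab). Qed.

Lemma label_face_next_range c : inner_corner r c -> 1 <= L (face_next G c) <= 4.
Proof. by rewrite -inner_face_next => /label_range. Qed.

Lemma degree_face_next c : face_degree (face_next G c) = face_degree c.
Proof. by rewrite /face_degree (face_eq (b := c)) // mem_face_next porbit_id. Qed.

Lemma degree_neq4 c : inner_corner r c -> face_degree c != 4 -> face_degree c = 3.
Proof. by case: G34 => _ _ deg /deg[->|->]. Qed.

Lemma triangle_face_next3 c : face_degree c = 3 ->
  face_next G (face_next G (face_next G c)) = c.
Proof. by move=> d; have := iter_face c; rewrite d. Qed.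

Lemma quad_face_next4 c : face_degree c = 4 ->
  face_next G (face_next G (face_next G (face_next G c))) = c.
Proof. by move=> d; have := iter_face c; rewrite d. Qed.

Lemma triangle_jumps c : inner_corner r c -> face_degree c = 3 ->
  jump (L c) (L (face_next G c)) +
  jump (L (face_next G c)) (L (face_next G (face_next G c))) +
  jump (L (face_next G (face_next G c))) (L c) = 4.
Proof.
move=> ic d; have := GS4_L1_face Lab ic.
rewrite big_face d /= !big_cons big_nil triangle_face_next3 //; lia.
Qed.

Lemma triangle_jump_le2 c : inner_corner r c -> face_degree c = 3 ->
  jump (L c) (L (face_next G c)) <= 2.
Proof.
move=> ic d; have := triangle_jumps ic d.
have ic1 : inner_corner r (face_next G c) by rewrite inner_face_next.
have ic2 : inner_corner r (face_next G (face_next G c)) by rewrite inner_face_next.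
have := GS4_L2 Lab ic1; have := GS4_L2 Lab ic2; rewrite triangle_face_next3 //; lia.
Qed.

Lemma quad_jump c : inner_corner r c -> face_degree c = 4 ->
  jump (L c) (L (face_next G c)) = 1.
Proof.
move=> ic d; have := GS4_L1_face Lab ic.
rewrite big_face d /= !big_cons big_nil quad_face_next4 //.
have ic1 : inner_corner r (face_next G c) by rewrite inner_face_next.
have ic2 : inner_corner r (face_next G (face_next G c)) by rewrite inner_face_next.
have ic3 : inner_corner r (face_next G (face_next G (face_next G c))).
  by rewrite inner_face_next.
have := GS4_L2 Lab ic; have := GS4_L2 Lab ic1; have := GS4_L2 Lab ic2.
have := GS4_L2 Lab ic3; rewrite quad_face_next4 //; lia.
Qed.

Lemma inner_arc_edge_ok a : inner_arc r a ->
  edge_ok (face_degree a == 3) (face_degree (flip G a) == 3)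
    (L a) (L (face_next G a)) (L (flip G a)) (L (face_next G (flip G a))).
Proof.
move=> ia; have /andP[ir il] := ia; rewrite -/(inner_corner r a) in ir.
rewrite -/(inner_corner r (flip G a)) in il.
have il' : inner_arc r (flip G a) by rewrite inner_arcE flipK il ir.
have side c : inner_arc r c -> (0 < jump (L c) (L (face_next G c)) <= 2) /\
   if face_degree c == 3 then 2 <= jump (L c) (L (face_next G c)) +
     jump (L (face_next G c)) (L (flip G c)) else jump (L c) (L (face_next G c)) == 1.
  move=> ic; have /andP[ic1 _] := ic; rewrite -/(inner_corner r c) in ic1.
  rewrite (GS4_L2 Lab ic1).
  have [d3|d3] := eqVneq (face_degree c) 3.
    by rewrite triangle_jump_le2 //= -cw_face_next (GS4_L3 Lab).
  have d4 : face_degree c = 4 by apply/eqP; apply: contraNT d3 => /degree_neq4->.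
  by rewrite quad_jump.
rewrite /edge_ok (edge_label_sum G34 Lab ia) eqxx; have [-> ->] := side _ ia.
by have [-> +] := side _ il'; rewrite flipK => ->.
Qed.

Lemma toward_inner a i : inner_arc r a ->
  toward a i = toward_labels (L a) (L (face_next G a)) (L (flip G a)) (L (face_next G (flip G
    a))) i.
Proof.
move=> ia; have ia' : inner_arc r (flip G a) by rewrite inner_arcE flipK andbC.
have /andP[ir il] := ia; rewrite -/(inner_corner r a) in ir.
rewrite -/(inner_corner r (flip G a)) in il.
have out b k : inner_arc r b -> (b == outer_arc r k = false) * (b == flip G (outer_arc r k) =
  false).
  move=> /andP[br fbr]; split; apply/eqP => bk.
    by have := outer_arc_mem r k; rewrite -bk; apply/negP.
  by move: fbr; rewrite bk flipK /outer_corner outer_arc_mem.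
rewrite /toward /A_odd /A_even /rt_label /lt_label /li_label /ri_label.
rewrite ia ia' !out // !orbF !andTb !flipK -!face_next_flip !flipK.
have := label_range ir; have := label_range il.
have := label_face_next_range ir; have := label_face_next_range il.
have eq_mod4 x k : 1 <= x <= 4 -> (x == k %[mod 4]) = (x == if k %% 4 is m.+1 then m.+1 else 4).
  have := ltn_pmod k (isT : 0 < 4).
  by case: x => [|[|[|[|[|x]]]]] //; case: (k %% 4) => [|[|[|[|k']]]].
move=> h1 h2 h3 h4; rewrite /toward_labels !eq_mod4 // -(modnDml i 1) -(modnDml i 2)
  -(modnDml i 3).
have := ltn_pmod i (isT : 0 < 4).
by case: (i %% 4) => [|[|[|[|]]]] //= _; do !case: (_ == _).
Qed.

Lemma flip_neq_outer a i : a \in face r -> (flip G a == outer_arc r i) = false.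
Proof.
move=> ar; apply/eqP => fa; have := flip_outer_inner G34 ar.
by rewrite fa outer_arc_mem.
Qed.

(** With the outer face on the right, the contour goes right from v_1 to v_4, up to v_3, left to v_2
    and down to v_1: the index of an outer arc is its direction. *)
Lemma toward_outer i k : 1 <= i <= 4 ->
  toward (outer_arc r i) k = (k == i %[mod 4]).
Proof.
move=> i14; have out j : inner_arc r (outer_arc r j) = false.
  by rewrite /inner_arc /outer_corner outer_arc_mem.
have out' j : inner_arc r (flip G (outer_arc r j)) = false.
  by rewrite inner_arcE flipK andbC; apply: out.
have nf j l : (flip G (outer_arc r j) == outer_arc r l) = false.
  by apply: flip_neq_outer => //; apply: outer_arc_mem.
have nf' j l : (outer_arc r j == flip G (outer_arc r l)) = false.
  by rewrite eq_sym nf.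
have ff j l : (flip G (outer_arc r j) == flip G (outer_arc r l)) =
   (outer_arc r j == outer_arc r l) by rewrite (inj_eq perm_inj).
have := outer_uniq G34; rewrite /= !inE !negb_or -!andbA.
move=> /andP[n14 /andP[n13 /andP[n12 /andP[n43 /andP[n42 /andP[n32 _]]]]]].
have eqs := (negPf n14, negPf n13, negPf n12, negPf n43, negPf n42, negPf n32).
have eqs' := (eqs, eq_sym (outer_arc r 4) (outer_arc r 1), eq_sym (outer_arc r 3) (outer_arc
  r 1),
  eq_sym (outer_arc r 2) (outer_arc r 1), eq_sym (outer_arc r 3) (outer_arc r 4),
  eq_sym (outer_arc r 2) (outer_arc r 4), eq_sym (outer_arc r 2) (outer_arc r 3)).
rewrite /toward /A_odd /A_even out out' !nf !nf' !ff !andFb !orFb.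
have := ltn_pmod k (isT : 0 < 4).
case: i i14 => [|[|[|[|[|i]]]]] // _; case: (k %% 4) => [|[|[|[|]]]] // _;
  by rewrite ?eqs' ?eqxx.
Qed.

Lemma right_specP c : inner_corner r c ->
  right_spec (face_degree c == 3) (jump (L c) (L (face_next G c)))
    (L c) (L (face_next G c)) (toward c).
Proof.
move=> ic; have [fr|fr] := boolP (flip G c \in face r); last first.
  have ia : inner_arc r c by rewrite inner_arcE ic.
  have /andP[+ _] := edge_okP (label_range ic) (label_face_next_range ic)
    (label_range fr) (label_face_next_range fr) (inner_arc_edge_ok ia).
  by rewrite /right_spec !toward_inner.
(* Along the outer contour, L0 fixes both labels and the direction of the arc is known. *)
have [i i14 ci] := outer_arc_exists G34 fr.
rewrite -(flipK c) ci.
have [-> ->] := label_flip_outer G34 Lab i14.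
rewrite /right_spec !toward_flip !toward_outer //.
by case: i i14 {ci} => [|[|[|[|[|i]]]]] //= _; case: eqP.
Qed.

Lemma toward_right c : inner_corner r c -> toward c (L c + 3).
Proof. by move=> /right_specP/and5P[]. Qed.

Lemma toward_right_opp c : inner_corner r c -> toward c (L c + 1) = false.
Proof. by move=> /right_specP/and3P[_ /negPf]. Qed.

Lemma toward_right_adj c : inner_corner r c ->
  ~~ (toward c (L c) && toward c (L c + 2)).
Proof. by move=> /right_specP/and3P[_ _ /andP[]]. Qed.

Lemma toward_triangle c : inner_corner r c -> face_degree c = 3 ->
  toward c (L c + 2) = false.
Proof.
move=> /right_specP/and5P[_ _ _ _ /and4P[_ _ + _]] d3; rewrite d3 /=.
by move/negPf.
Qed.

Lemma toward_triangle_jump2 c : inner_corner r c -> face_degree c = 3 ->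
  jump (L c) (L (face_next G c)) = 2 -> toward c (L c).
Proof.
by move=> /right_specP/and5P[_ _ _ _ /and4P[_ _ _ +]] d3 j; rewrite d3 j eqxx.
Qed.

Lemma toward_left a : inner_corner r (flip G a) ->
  toward a (L (face_next G (flip G a))).
Proof.
move=> /right_specP/and5P[_ _ _ + _]; rewrite toward_flip -addnA => h.
by rewrite (toward_mod _ (esym (modnDr _ 4))).
Qed.

Lemma toward_left_opp a : inner_corner r (flip G a) ->
  toward a (L (face_next G (flip G a)) + 2) = false.
Proof. by move=> /right_specP/and5P[_ _ _ _ /andP[+ _]]; rewrite toward_flip => /negPf. Qed.

Lemma toward_left_adj a : inner_corner r (flip G a) ->
  ~~ (toward a (L (face_next G (flip G a))).+1 && toward a (L (face_next G (flip G a))).+3).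
Proof.
move=> /right_specP/and5P[_ _ _ _ /and3P[_ + _]]; rewrite !toward_flip andbC.
move: (L _) => l; rewrite (toward_mod _ (_ : l + 3 + 2 = l.+1 %[mod 4])); last lia.
by rewrite (toward_mod _ (_ : l + 1 + 2 = l.+3 %[mod 4])) //; lia.
Qed.

Lemma jump_inner_arc a : inner_arc r a ->
  let l := L (face_next G (flip G a)) in
  (jump l (L a) <= 2) &&
  (2 * jump l (L a) + (1 + toward a (L a) - toward a (L a).+2) ==
   2 + (1 + toward a l.+1 - toward a l.+3)).
Proof.
move=> ia; have /andP[ir il] := ia.
rewrite -/(inner_corner r a) in ir; rewrite -/(inner_corner r (flip G a)) in il.
have /andP[_] := edge_okP (label_range ir) (label_face_next_range ir)
    (label_range il) (label_face_next_range il) (inner_arc_edge_ok ia).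
by rewrite /jump_spec -!toward_inner.
Qed.

(** The labels turn once around an inner vertex, so some jump passes over the given direction; as
    the jump across an arc is at most 2, the arc where this happens points that way. *)
Lemma inner_vertex_toward a i : inner_vertex r (init_vertex a) ->
  exists2 b, init_vertex b = init_vertex a & toward b i.
Proof.
move=> iv; have inn c : c \in porbit (cw G) a -> inner_corner r c.
  by move/init_vertexP; apply: iv.
(* The residue of [L c + 3 - i]. It wraps around where adding the next jump reaches 4; without any
   wrap [g] would grow by each jump along the tour, and the jumps would add up to 0. *)
pose g c := (L c + 3 + 4 - i %% 4) %% 4.
have := GS4_L1_vertex Lab iv.
have [/existsP[c /andP[ca cross_i]] _|] :=
  boolP [exists c in porbit (cw G) a, 4 <= g c + jump (L c) (L (cw G c))].
  have ca' : cw G c \in porbit (cw G) a by rewrite mem_porbit_step.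
  exists (cw G c); first by rewrite init_vertex_cw; apply/init_vertexP.
  have il : inner_corner r (flip G (cw G c)) by rewrite -inner_face_next face_next_flip_cw inn.
  have ia : inner_arc r (cw G c) by rewrite inner_arcE il inn.
  have := jump_inner_arc ia; rewrite /= face_next_flip_cw => /andP[j2 _].
  have := toward_left il; have := toward_right (inn _ ca'); rewrite face_next_flip_cw.
  have i4 := ltn_pmod i (isT : 0 < 4).
  have := label_range (inn _ ca'); have := label_range (inn _ ca).
  move=> h1 h2 t1 t2.
  have [e|e] : L c = i %[mod 4] \/ L (cw G c) + 3 = i %[mod 4].
  - move: j2 cross_i; rewrite /g /jump; lia.
  - by rewrite -(toward_mod _ e).
  - by rewrite -(toward_mod _ e).
rewrite negb_exists => /forallP no.
have gE : \sum_(c in porbit (cw G) a) g (cw G c) = \sum_(c in porbit (cw G) a) g c.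
  rewrite [RHS](reindex_inj (@perm_inj _ (cw G))) /=.
  by apply: eq_bigl => c; rewrite mem_porbit_step.
have : \sum_(c in porbit (cw G) a) (g c + jump (L c) (L (cw G c))) =
   \sum_(c in porbit (cw G) a) g (cw G c).
  apply: eq_bigr => c ca; have := no c; rewrite ca /= -ltnNge.
  have ca' : cw G c \in porbit (cw G) a by rewrite mem_porbit_step.
  have i4 := ltn_pmod i (isT : 0 < 4).
  have := label_range (inn _ ca'); have := label_range (inn _ ca).
  rewrite /g /jump; lia.
rewrite big_split /= gE; lia.
Qed.

End ArcDirections.

Import Order.TTheory GRing.Theory Num.Theory.
Local Open Scope ring_scope.

(** * Shapes of the inner faces *)

(** Here [b1], [b1'] are the two orientations of one side and [b3], [b3'] those of the opposite
    side. The last two hypotheses suffice unless [p1 < p2] and [p4 < p3], or [p2 < p1] and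
    [p3 < p4]; in these cases one inequality is missing, and a diagonal arc provides it. *)
Lemma separation (R : realDomainType) (p1 p2 p3 p4 : R) (b1 b1' b3 b3' : bool) :
  (b1 = false -> b1' = false -> p1 = p2) -> (b1 -> p1 < p2) -> (b1' -> p2 < p1) ->
  (b3 = false -> b3' = false -> p3 = p4) -> (b3 -> p3 < p4) -> (b3' -> p4 < p3) ->
  (b1 -> b3' -> p2 < p4) -> (b1' -> b3 -> p1 < p3) -> p2 < p3 -> p4 > p1 ->
  [/\ p1 < p3, p1 < p4, p2 < p3 & p2 < p4].
Proof.
have tri (p q : R) (b b' : bool) : (b = false -> b' = false -> p = q) -> (b -> p < q) ->
    (b' -> q < p) -> [\/ b /\ p < q, b' /\ q < p | p = q].
  case: b => [_ /(_ isT) h _|]; first by constructor 1.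
  case: b' => [_ _ /(_ isT) h|]; first by constructor 2.
  by move=> /(_ erefl erefl) h _ _; constructor 3.
move=> /tri/[apply]/[apply] t12 /tri/[apply]/[apply] t34 d24 d13 h23 h14.
case: t12 t34 => [[b l]|[b l]|l] [[b' l']|[b' l']|l'].
- by split; lra.
- by have := d24 b b'; split; lra.
- by split; lra.
- by have := d13 b b'; split; lra.
all: by split; lra.
Qed.

Section Positions.

Variables (R : realType) (G : planar_map) (r : G) (L : G -> nat).
Variables (x y : vertex G -> R).
Implicit Types a b c : G.

Local Notation pos := (fun v : vertex G => (x v, y v)).
Local Notation vec := (vector_of pos).
Local Notation next := (face_next G).

Lemma vec_flip a : vec (flip G a) = (- (vec a).1, - (vec a).2).
Proof. by rewrite /vector_of term_flip /= !opprB. Qed.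

Hypothesis G34 : angulation34_of_square r.
Hypothesis Lab : GS4_labeling r L.
Hypothesis x_incr : odd_increasing r L x.
Hypothesis y_incr : even_increasing r L y.

Lemma toward0 a : toward r L a 0 -> y (init_vertex a) < y (term_vertex a).
Proof. by case: y_incr => _ + _ ta; apply. Qed.

Lemma toward1 a : toward r L a 1 -> x (init_vertex a) < x (term_vertex a).
Proof. by case: x_incr => _ + _ ta; apply. Qed.

Lemma toward2 a : toward r L a 2 -> y (term_vertex a) < y (init_vertex a).
Proof. by case: y_incr => _ + _ => /[apply]; rewrite term_flip. Qed.

Lemma toward3 a : toward r L a 3 -> x (term_vertex a) < x (init_vertex a).
Proof. by case: x_incr => _ + _ => /[apply]; rewrite term_flip. Qed.

Lemma toward_x_eq a : toward r L a 1 = false -> toward r L a 3 = false ->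
  x (init_vertex a) = x (term_vertex a).
Proof. by case: x_incr => + _ _ t1 t3; apply; apply/negbT. Qed.

Lemma toward_y_eq a : toward r L a 0 = false -> toward r L a 2 = false ->
  y (init_vertex a) = y (term_vertex a).
Proof. by case: y_incr => + _ _ t0 t2; apply; apply/negbT. Qed.

Definition dir_coord (i : nat) (u : R * R) : R :=
  match (i %% 4)%N with 0%N => u.2 | 1%N => u.1 | 2%N => - u.2 | _ => - u.1 end.

Lemma dir_coord_opp i u : dir_coord (i + 2) u = - dir_coord i u.
Proof.
rewrite /dir_coord -(modnDml i 2); have := ltn_pmod i (isT : (0 < 4)%N).
by case: (i %% 4)%N => [|[|[|[|]]]] //= _; rewrite opprK.
Qed.

(** The cross product is invariant under quarter turns, so it can be computed in the frame of any
    direction. *)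
Lemma crossE i u v : cross u v = dir_coord i.+1 u * dir_coord i v - dir_coord i u * dir_coord
  i.+1 v.
Proof.
rewrite /cross /dir_coord -addn1 -(modnDml i 1); have := ltn_pmod i (isT : (0 < 4)%N).
by case: (i %% 4)%N => [|[|[|[|]]]] //= _; ring.
Qed.

Lemma dir_coord_toward a i : toward r L a i -> 0 < dir_coord i (vec a).
Proof.
rewrite /dir_coord; have := @toward_mod G r L a i (i %% 4); rewrite modn_mod => -> //.
have := ltn_pmod i (isT : (0 < 4)%N).
case: (i %% 4)%N => [|[|[|[|]]]] //= _.
- by move/toward0; lra.
- by move/toward1; lra.
- by move/toward2; lra.
- by move/toward3; lra.
Qed.

(** An arc that points neither toward [i] nor the opposite way lies on an edge contracted for that
    coordinate, which is then equal at both ends. *)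
Lemma dir_coord_ge0 a i : toward r L a (i + 2) = false -> 0 <= dir_coord i (vec a).
Proof.
move=> ti2; have [/dir_coord_toward/ltW//|] := boolP (toward r L a i).
move: ti2; rewrite /dir_coord; have := @toward_mod G r L a i (i %% 4);
  rewrite modn_mod => -> //.
have := @toward_mod G r L a (i + 2) (i %% 4 + 2); rewrite modnDml => -> //.
have := ltn_pmod i (isT : (0 < 4)%N).
case: (i %% 4)%N => [|[|[|[|]]]] //= _ t1 /negbTE t2.
- by rewrite (toward_y_eq t2 t1) subrr.
- by rewrite (toward_x_eq t2 t1) subrr.
- by rewrite (toward_y_eq t1 t2) subrr oppr0.
- by rewrite (toward_x_eq t1 t2) subrr oppr0.
Qed.

Lemma vec_sum3 a : face_degree a = 3 ->
  vec (next (next a)) = (- ((vec a).1 + (vec (next a)).1), - ((vec a).2 + (vec (next a)).2)).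
Proof.
move=> d; rewrite /vector_of -!init_face_next (triangle_face_next3 d).
by congr (_, _) => /=; ring.
Qed.

(** The three jumps are positive and add up to 4, so one of the first two is 1. As the sides add up
    to 0, the cross product is the same at every corner, and one corner that follows a jump of 1 is
    enough. *)
Lemma triangle_turn a : inner_corner r a -> face_degree a = 3 ->
  cross (vec a) (vec (next a)) < 0.
Proof.
have turn1 c : inner_corner r c -> face_degree c = 3 ->
    jump (L c) (L (next c)) = 1%N -> cross (vec c) (vec (next c)) < 0.
  move=> ic d j; set l := L c.
  have ic' : inner_corner r (next c) by rewrite inner_face_next.
  have d' : face_degree (next c) = 3 by rewrite degree_face_next.
  have l1 : (L (next c) = l + 1 %[mod 4])%N.
    have := label_range Lab ic; have := label_range Lab ic'; move: j.
    rewrite /jump -/l; lia.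
  (* The side [c] lies between the directions [l + 3] and [l], the next side between [l] and
     [l + 1], and each has a positive component along the first of its two directions. *)
  have h1 := dir_coord_toward (toward_right G34 Lab ic).
  have h2 : 0 <= dir_coord (L c) (vec c) by apply: dir_coord_ge0; apply: toward_triangle.
  have h3 : 0 < dir_coord l (vec (next c)).
    apply: dir_coord_toward; have := toward_right G34 Lab ic'.
    by rewrite (toward_mod _ _ _ (_ : _ = l %[mod 4])) //; move: l1; lia.
  have h4 : 0 <= dir_coord (l + 1) (vec (next c)).
    apply: dir_coord_ge0; have := toward_triangle G34 Lab ic' d'.
    by rewrite (toward_mod _ _ _ (_ : _ = l + 1 + 2 %[mod 4])) //; move: l1; lia.
  have e3 : dir_coord (l + 3) (vec (next c)) = - dir_coord (l + 1) (vec (next c)).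
    by rewrite -dir_coord_opp -addnA.
  rewrite (crossE (l + 3)) e3.
  have e4 u : dir_coord (l + 3).+1 u = dir_coord l u by rewrite /dir_coord -addnS modnDr.
  by rewrite !e4; move: h1 h2 h3 h4; rewrite -/l; nra.
move=> ia d; have := triangle_jumps Lab ia d; have := triangle_jump_le2 Lab ia d.
have ia1 : inner_corner r (next a) by rewrite inner_face_next.
have ia2 : inner_corner r (next (next a)) by rewrite inner_face_next.
have d1 : face_degree (next a) = 3 by rewrite degree_face_next.
have := GS4_L2 Lab ia; have := GS4_L2 Lab ia1; have := GS4_L2 Lab ia2.
rewrite (triangle_face_next3 d).
have [/(turn1 a ia d)//|j1 p2 p1 p0 le2 sum4] := eqVneq (jump (L a) (L (next a))) 1%N.
have := turn1 _ ia1 d1; rewrite vec_sum3 //.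
suff -> : jump (L (next a)) (L (next (next a))) = 1%N by rewrite /cross /= => /(_ erefl); lra.
lia.
Qed.

Lemma quad_labels c : quad_corner1 r L c ->
  [/\ L (next c) = 2%N, L (next (next c)) = 3%N & L (next (next (next c))) = 4%N].
Proof.
move=> [ic d l1].
have succ b k : inner_corner r b -> face_degree b = 4 -> L b = k -> (k < 4)%N ->
    L (next b) = k.+1.
  move=> ib db lb k4; have := quad_jump Lab ib db; rewrite lb.
  have ib' : inner_corner r (next b) by rewrite inner_face_next.
  by have := label_range Lab ib; have := label_range Lab ib'; rewrite /jump lb; lia.
have l2 := succ c _ ic d l1 isT.
have l3 := succ (next c) _ _ _ l2 isT; rewrite inner_face_next degree_face_next in l3.
have := succ (next (next c)) _ _ _ (l3 ic d) isT.
rewrite !inner_face_next !degree_face_next => /(_ ic d) l4.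
by split=> //; apply: l3.
Qed.

Lemma quad_corner1_exists c : inner_corner r c -> face_degree c = 4 ->
  exists2 c1, c1 \in face c & quad_corner1 r L c1.
Proof.
move=> ic d.
have succ b : b \in face c -> [/\ next b \in face c, (1 <= L b <= 4)%N &
    jump (L b) (L (next b)) = 1%N].
  move=> bc; have ib : inner_corner r b by rewrite (inner_corner_face r bc).
  have db : face_degree b = 4 by rewrite /face_degree (face_eq bc).
  by split; [rewrite mem_face_next|apply: (label_range Lab)|apply: (quad_jump Lab)].
have [b bc lb] : exists2 b, b \in face c & L b = 1%N.
  have c0 : c \in face c by apply: porbit_id.
  have [c1 r0 j0] := succ _ c0; have [c2 r1 j1] := succ _ c1.
  have [c3 r2 j2] := succ _ c2; have [_ r3 j3] := succ _ c3.
  have [e|[e|[e|e]]] : L c = 1%N \/ L (next c) = 1%N \/ L (next (next c)) = 1%N \/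
      L (next (next (next c))) = 1%N.
    by move: r0 r1 r2 r3 j0 j1 j2; rewrite /jump; lia.
  - by exists c.
  - by exists (next c).
  - by exists (next (next c)).
  - by exists (next (next (next c))).
exists b => //; split=> //; first by rewrite (inner_corner_face r bc).
by rewrite /face_degree (face_eq bc).
Qed.

Lemma quad_separated c1 : quad_corner1 r L c1 ->
  let c2 := next c1 in let c3 := next c2 in let c4 := next c3 in
  let x1 := x (init_vertex c1) in let x2 := x (init_vertex c2) in
  let x3 := x (init_vertex c3) in let x4 := x (init_vertex c4) in
  let y1 := y (init_vertex c1) in let y2 := y (init_vertex c2) in
  let y3 := y (init_vertex c3) in let y4 := y (init_vertex c4) in
  [/\ x1 < x3, x1 < x4, x2 < x3 & x2 < x4] /\ [/\ y1 < y2, y1 < y3, y4 < y2 & y4 < y3].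
Proof.
move=> q; have [l2 l3 l4] := quad_labels q; have [ic d l1] := q => c2 c3 c4.
have ic2 : inner_corner r c2 by rewrite inner_face_next.
have ic3 : inner_corner r c3 by rewrite inner_face_next.
have ic4 : inner_corner r c4 by rewrite inner_face_next.
have t1 : toward r L c1 0 by have := toward_right G34 Lab ic; rewrite l1.
have t2 : toward r L c2 1 by have := toward_right G34 Lab ic2; rewrite l2.
have t3 : toward r L c3 2 by have := toward_right G34 Lab ic3; rewrite l3.
have t4 : toward r L c4 3 by have := toward_right G34 Lab ic4; rewrite l4.
have := (toward0 t1, toward1 t2, toward2 t3, toward3 t4).
have [_ _ xd] := x_incr; have [_ _ yd] := y_incr.
have x24 : toward r L c1 1 -> toward r L c3 3 -> x (init_vertex c2) < x (init_vertex c4).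
  by move=> h1 h2; apply: xd; exists c1 => //; left.
have x13 : toward r L c1 3 -> toward r L c3 1 -> x (init_vertex c1) < x (init_vertex c3).
  by move=> h1 h2; apply: xd; exists c1 => //; right.
have y42 : toward r L c4 2 -> toward r L c2 0 -> y (init_vertex c4) < y (init_vertex c2).
  by move=> h1 h2; apply: yd; exists c1 => //; left.
have y13 : toward r L c4 0 -> toward r L c2 2 -> y (init_vertex c1) < y (init_vertex c3).
  by move=> h1 h2; apply: yd; exists c1 => //; right.
have a1 := @toward_x_eq c1; have a3 := @toward_x_eq c3.
have a2 := @toward_y_eq c2; have a4 := @toward_y_eq c4.
have x1 := @toward1 c1; have x1' := @toward3 c1.
have x3 := @toward1 c3; have x3' := @toward3 c3.
have y2 := @toward0 c2; have y2' := @toward2 c2.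
have y4 := @toward0 c4; have y4' := @toward2 c4.
move: a1 a2 a3 a4 x1 x1' x3 x3' y2 y2' y4 y4'.
rewrite -!init_face_next -/c2 -/c3 -/c4 (quad_face_next4 d).
move=> a1 a2 a3 a4 x1 x1' x3 x3' y2 y2' y4 y4' [[[h1 h2] h3] h4].
split.
  exact: separation a1 x1 x1' a3 x3 x3' x24 x13 h2 h4.
(* For the ordinates the vertices are taken in the order u_1, u_4, u_3, u_2. *)
have [] := separation (fun p q => esym (a4 q p)) y4' y4 (fun p q => esym (a2 q p)) y2' y2 y42
  y13 h3 h1.
by split.
Qed.

End Positions.

(** * Sweeping by a vertical line *)

Section Sweep.

Variables (R : realType) (G : planar_map) (x y : vertex G -> R).
Implicit Types (a b e u : G) (t : R).

Local Notation next := (face_next G).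
Local Notation vec := (vector_of (fun v : vertex G => (x v, y v))).

(** The arcs met from left to right by the vertical line [X = t], shifted
    infinitesimally to the right. *)
Definition vcrosses t a := (x (init_vertex a) <= t) && (t < x (term_vertex a)).

Definition vslope a : R := (vec a).2 / (vec a).1.
Definition vheight t a : R := y (init_vertex a) + (t - x (init_vertex a)) * vslope a.

(** At equal heights on [X = t], the slopes decide on the shifted line. *)
Definition vlower t a b :=
  (vheight t a < vheight t b) || (vheight t a == vheight t b) && (vslope a < vslope b).

Lemma lower_irr t a : vlower t a a = false.
Proof. by rewrite /vlower !ltxx andbF. Qed.

Lemma lower_le_trans t a b c : ~~ vlower t b a -> vlower t b c -> vlower t a c.
Proof.
rewrite /vlower negb_or negb_and -!leNgt => /andP[h1 h2] h3; apply/orP.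
case/orP: h3 => [h3|/andP[/eqP h3 h4]].
  by left; apply: le_lt_trans h3.
move: h1; rewrite le_eqVlt => /predU1P[h1|h1]; last by left; rewrite -h3.
right; rewrite h1 h3 eqxx /=; move: h2; rewrite h1 eqxx /= => h2.
exact: le_lt_trans h4.
Qed.

Lemma not_lowerC t a b : vlower t a b -> ~~ vlower t b a.
Proof.
rewrite /vlower negb_or negb_and -!leNgt => /orP[h|/andP[/eqP-> h]].
  by rewrite ltW //= (gt_eqF h).
by rewrite lexx ltW // orbT.
Qed.

Lemma crosses_dx t a : vcrosses t a -> 0 < (vec a).1.
Proof. by case/andP => h1 h2; rewrite /= subr_gt0 (le_lt_trans h1). Qed.

Lemma vec_slope a : 0 < (vec a).1 -> (vec a).2 = vslope a * (vec a).1.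
Proof. by move=> h; rewrite /vslope divfK // gt_eqF. Qed.

Lemma height_term t a : 0 < (vec a).1 ->
  vheight t a = y (term_vertex a) + (t - x (term_vertex a)) * vslope a.
Proof. by move=> /vec_slope h; rewrite /vheight; move: h => /=; lra. Qed.

Lemma slope_lt a b : 0 < (vec a).1 -> 0 < (vec b).1 ->
  (vslope a < vslope b) = (cross (vec b) (vec a) < 0).
Proof.
move=> ha hb; rewrite /cross (vec_slope ha) (vec_slope hb).
have -> : (vec b).1 * (vslope a * (vec a).1) - vslope b * (vec b).1 * (vec a).1 =
  (vslope a - vslope b) * ((vec a).1 * (vec b).1) by ring.
by rewrite pmulr_llt0 ?mulr_gt0 // subr_lt0.
Qed.

(** What holds when [e] and [u] bound an inner face from below and from above; in the
    first case the face may have height 0 on [X = t]. *)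
Definition vbounds t e u :=
  (init_vertex e = init_vertex u /\ vslope e < vslope u) \/ vheight t e < vheight t u.

Lemma bounds_lower t e u : vcrosses t e -> vbounds t e u -> vlower t e u.
Proof.
rewrite /vlower => /andP[ce _] [[eu s]|->//].
case: ltgtP => //= h.
by move: h ce s; rewrite /vheight -eu /=; nra.
Qed.

(** A clockwise contour goes right along its upper part and left along its lower part, hence the
    roles of [u] and [d]. *)
Definition vswept t (F : {set G}) :=
  (forall a, a \in F -> ~~ vcrosses t a && ~~ vcrosses t (flip G a)) \/
  exists u d, [/\ u \in F, d \in F, vcrosses t u, vcrosses t (flip G d) &
      vbounds t (flip G d) u] /\
    (forall a, a \in F -> (vcrosses t a -> a = u) /\ (vcrosses t (flip G a) -> a = d)).

Lemma bounds_left t a : cross (vec a) (vec (next a)) < 0 ->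
  vcrosses t (flip G a) -> vcrosses t (next a) -> vbounds t (flip G a) (next a).
Proof.
move=> turn ca cn; left; split; first by rewrite init_face_next.
rewrite slope_lt ?(crosses_dx ca) ?(crosses_dx cn) //.
by move: turn; rewrite vec_flip /cross /=; lra.
Qed.

(** Both edges reach their common vertex strictly to the right of the line, so the order of the
    heights is opposite to that of the slopes. *)
Lemma bounds_right t a : cross (vec a) (vec (next a)) < 0 ->
  vcrosses t a -> vcrosses t (flip G (next a)) -> vbounds t (flip G (next a)) a.
Proof.
move=> turn ca cn; right;
  rewrite (height_term t (crosses_dx ca)) (height_term t (crosses_dx cn)).
rewrite term_flip init_face_next ltrD2l.
have h : vslope a < vslope (flip G (next a)).
  rewrite slope_lt ?(crosses_dx ca) ?(crosses_dx cn) //.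
  by move: turn; rewrite vec_flip /cross /=; lra.
have : t < x (term_vertex a) by case/andP: ca.
by move: h; nra.
Qed.

Let low t (v : vertex G) := x v <= t.

Let crossesE t a : vcrosses t a = low t (init_vertex a) && ~~ low t (term_vertex a).
Proof. by rewrite /vcrosses /low -ltNge. Qed.

Let crosses_flipE t a : vcrosses t (flip G a) = low t (term_vertex a) && ~~ low t
  (init_vertex a).
Proof. by rewrite crossesE term_flip. Qed.

Lemma swept_triangle t a : face_degree a = 3 ->
  cross (vec a) (vec (next a)) < 0 -> vswept t (face a).
Proof.
move=> d turn0; have e3 := triangle_face_next3 d.
have v2 := vec_sum3 x y d.
have turn1 : cross (vec (next a)) (vec (next (next a))) < 0.
  by rewrite v2; move: turn0; rewrite /cross /=; lra.
have turn2 : cross (vec (next (next a))) (vec a) < 0.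
  by rewrite v2; move: turn0; rewrite /cross /=; lra.
have mem b : (b \in face a) = [|| b == a, b == next a | b == next (next a)].
  by rewrite face_mem d /= !inE.
have mem0 : a \in face a by rewrite mem eqxx.
have mem1 : next a \in face a by rewrite mem eqxx orbT.
have mem2 : next (next a) \in face a by rewrite mem eqxx !orbT.
have bl0 := bounds_left (t := t) turn0; have br0 := bounds_right (t := t) turn0.
have bl1 := bounds_left (t := t) turn1; have br1 := bounds_right (t := t) turn1.
rewrite -{2}e3 in turn2.
have bl2 := bounds_left (t := t) turn2; have br2 := bounds_right (t := t) turn2.
rewrite e3 in bl2 br2.
have c0 := crossesE t a; have c0' := crosses_flipE t a.
have c1 := crossesE t (next a); have c1' := crosses_flipE t (next a).
have c2 := crossesE t (next (next a)); have c2' := crosses_flipE t (next (next a)).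
rewrite -!init_face_next e3 in c0 c0' c1 c1' c2 c2'.
(* There are eight cases. When one vertex is alone on its side of the line, the two crossed sides
   meet there, and [bounds_left] or [bounds_right] applies. *)
case: (low t (init_vertex a)) c0 c0' c1 c1' c2 c2';
  case: (low t (init_vertex (next a)));
  case: (low t (init_vertex (next (next a)))) => c0 c0' c1 c1' c2 c2'.
1,8: by left => b; rewrite mem => /or3P[] /eqP->; rewrite ?c0 ?c0' ?c1 ?c1' ?c2 ?c2'.
all: right.
- exists (next a), (next (next a)).
  split; first split; rewrite ?c1 ?c2' //; first exact: br1.
  by move=> b; rewrite mem => /or3P[] /eqP->; rewrite ?c0 ?c0' ?c1 ?c1' ?c2 ?c2'.
- exists a, (next a).
  split; first split; rewrite ?c0 ?c1' //; first exact: br0.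
  by move=> b; rewrite mem => /or3P[] /eqP->; rewrite ?c0 ?c0' ?c1 ?c1' ?c2 ?c2'.
- exists a, (next (next a)).
  split; first split; rewrite ?c0 ?c2' //; first exact: bl2.
  by move=> b; rewrite mem => /or3P[] /eqP->; rewrite ?c0 ?c0' ?c1 ?c1' ?c2 ?c2'.
- exists (next (next a)), a.
  split; first split; rewrite ?c2 ?c0' //; first exact: br2.
  by move=> b; rewrite mem => /or3P[] /eqP->; rewrite ?c0 ?c0' ?c1 ?c1' ?c2 ?c2'.
- exists (next a), a.
  split; first split; rewrite ?c1 ?c0' //; first exact: bl0.
  by move=> b; rewrite mem => /or3P[] /eqP->; rewrite ?c0 ?c0' ?c1 ?c1' ?c2 ?c2'.
- exists (next (next a)), (next a).
  split; first split; rewrite ?c2 ?c1' //; first exact: bl1.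
  by move=> b; rewrite mem => /or3P[] /eqP->; rewrite ?c0 ?c0' ?c1 ?c1' ?c2 ?c2'.
Qed.

Lemma height_bounds t a m M : vcrosses t a ->
  m <= y (init_vertex a) <= M -> m <= y (term_vertex a) <= M -> m <= vheight t a <= M.
Proof.
move=> ca hi ht; have dx := crosses_dx ca; have e := vec_slope dx.
have e' := height_term t dx.
case/andP: ca => c1 c2; move: e e' dx hi ht; rewrite /vheight /=.
set s := vslope a; move: (x _) (x _) (y _) (y _) c1 c2 => xt xi yi yt c1 c2 e _ dx /andP[i1
  i2] /andP[t1 t2].
(* Multiplying by the width of the arc writes the height as a combination of the end heights with
   nonnegative weights. *)
have conv k : (yi + (t - xi) * s - k) * (xt - xi) = (yi - k) * (xt - t) + (yt - k) * (t - xi).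
  have -> : yt = yi + s * (xt - xi) by lra.
  ring.
apply/andP; split.
- by rewrite -subr_ge0 -(pmulr_lge0 _ dx) conv addr_ge0 // mulr_ge0; lra.
- by rewrite -subr_le0 -(pmulr_lle0 _ dx) conv; nra.
Qed.

(** The quadrangle may have a reflex corner, but not at a strictly leftmost or rightmost vertex.
    Each premise makes the corner concerned such a vertex. *)
Lemma quad_turns a :
  let b := next a in let c := next b in let d := next c in
  face_degree a = 4 ->
  let x1 := x (init_vertex a) in let x2 := x (init_vertex b) in
  let x3 := x (init_vertex c) in let x4 := x (init_vertex d) in
  let y1 := y (init_vertex a) in let y2 := y (init_vertex b) in
  let y3 := y (init_vertex c) in let y4 := y (init_vertex d) in
  [/\ x1 < x3, x1 < x4, x2 < x3 & x2 < x4] ->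
  [/\ y1 < y2, y1 < y3, y4 < y2 & y4 < y3] ->
  [/\ x1 < x2 -> cross (vec d) (vec a) < 0, x2 < x1 -> cross (vec a) (vec b) < 0,
      x4 < x3 -> cross (vec b) (vec c) < 0 & x3 < x4 -> cross (vec c) (vec d) < 0].
Proof.
move=> b c d deg x1 x2 x3 x4 y1 y2 y3 y4 [x13 x14 x23 x24] [y12 y13 y42 y43].
have e4 : next d = a by apply: quad_face_next4.
have va : vec a = (x2 - x1, y2 - y1) by rewrite /vector_of -init_face_next.
have vb : vec b = (x3 - x2, y3 - y2) by rewrite /vector_of -init_face_next.
have vc : vec c = (x4 - x3, y4 - y3) by rewrite /vector_of -init_face_next.
have vd : vec d = (x1 - x4, y1 - y4) by rewrite /vector_of -init_face_next e4.
by rewrite va vb vc vd /cross /=; split=> h; nra.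
Qed.

Lemma swept_quad t a :
  let b := next a in let c := next b in let d := next c in
  face_degree a = 4 ->
  let x1 := x (init_vertex a) in let x2 := x (init_vertex b) in
  let x3 := x (init_vertex c) in let x4 := x (init_vertex d) in
  let y1 := y (init_vertex a) in let y2 := y (init_vertex b) in
  let y3 := y (init_vertex c) in let y4 := y (init_vertex d) in
  [/\ x1 < x3, x1 < x4, x2 < x3 & x2 < x4] ->
  [/\ y1 < y2, y1 < y3, y4 < y2 & y4 < y3] -> vswept t (face a).
Proof.
move=> b c d deg x1 x2 x3 x4 y1 y2 y3 y4 hx hy.
have [tda tab tbc tcd] := quad_turns deg hx hy.
move: hx hy => [x13 x14 x23 x24] [y12 y13 y42 y43].
have e4 : next d = a by apply: quad_face_next4.
have mem e : (e \in face a) = [|| e == a, e == b, e == c | e == d].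
  by rewrite face_mem deg /= !inE.
have mem0 : a \in face a by rewrite mem eqxx.
have mem1 : b \in face a by rewrite mem eqxx orbT.
have mem2 : c \in face a by rewrite mem eqxx !orbT.
have mem3 : d \in face a by rewrite mem eqxx !orbT.
have ca := crossesE t a; have ca' := crosses_flipE t a.
have cb := crossesE t b; have cb' := crosses_flipE t b.
have cc := crossesE t c; have cc' := crosses_flipE t c.
have cd := crossesE t d; have cd' := crosses_flipE t d.
rewrite -!init_face_next -/b -/c -/d e4 in ca ca' cb cb' cc cc' cd cd'.
have {}tda : x1 < x2 -> cross (vec d) (vec (next d)) < 0 by rewrite e4.
(* The heights on [b] lie between [y2] and [y3], those on [d] between [y1] and [y4], and the
   ordinates are separated. *)
have top_bottom : vcrosses t b -> vcrosses t (flip G d) -> vbounds t (flip G d) b.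
  move=> h1 h2; right.
  have minmax (p q : R) : (Num.min p q <= p <= Num.max p q) * (Num.min p q <= q <= Num.max p q).
    by rewrite !ge_min !le_max !lexx !orbT.
  have hb m M := @height_bounds t b m M h1; rewrite -init_face_next -/c in hb.
  have hd m M := @height_bounds t (flip G d) m M h2.
  rewrite term_flip -/(term_vertex d) -init_face_next e4 in hd.
  have /andP[h4 _] := hb _ _ (minmax y2 y3).1 (minmax y2 y3).2.
  have /andP[_ h3] := hd _ _ (minmax y1 y4).1 (minmax y1 y4).2.
  apply: le_lt_trans h3 (lt_le_trans _ h4).
  by rewrite gt_max !lt_min y12 y13 y42 y43.
have lowlt v w : low t v -> ~~ low t w -> x v < x w.
  by rewrite /low -ltNge; apply: le_lt_trans.
have low_mono v w : x v < x w -> low t w -> low t v.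
  by rewrite /low => h1 h2; apply: le_trans (ltW h1) h2.
have := (lowlt (init_vertex a) (init_vertex b), lowlt (init_vertex b) (init_vertex a)).
have := (lowlt (init_vertex c) (init_vertex d), lowlt (init_vertex d) (init_vertex c)).
have := (low_mono _ _ x13, low_mono _ _ x14); have := (low_mono _ _ x23, low_mono _ _ x24).
(* Seven of the sixteen patterns respect the separation of the abscissas: two without crossing, four
   that isolate one vertex, and one that splits the face into its left and right pairs. *)
case: (low t (init_vertex a)) ca ca' cb cb' cc cc' cd cd';
  case: (low t (init_vertex b)); case: (low t (init_vertex c));
  case: (low t (init_vertex d)) => /= ca ca' cb cb' cc cc' cd cd' [m23 m24] [m13 m14] [l34
    l43] [l12 l21].
all: try by [have := m13 isT|have := m14 isT|have := m23 isT|have := m24 isT].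
1,7: by left => e; rewrite mem => /or4P[] /eqP->; rewrite ?ca ?cb ?cc ?cd ?ca' ?cb' ?cc' ?cd'.
all: right.
- exists c, d.
  split; first split; rewrite ?ca ?cb ?cc ?cd ?ca' ?cb' ?cc' ?cd' //;
    first exact: (bounds_right (tcd (l34 isT isT))) cc cd'.
  by move=> e; rewrite mem => /or4P[] /eqP->; rewrite ?ca ?cb ?cc ?cd ?ca' ?cb' ?cc' ?cd'.
- exists b, c.
  split; first split; rewrite ?ca ?cb ?cc ?cd ?ca' ?cb' ?cc' ?cd' //;
    first exact: (bounds_right (tbc (l43 isT isT))) cb cc'.
  by move=> e; rewrite mem => /or4P[] /eqP->; rewrite ?ca ?cb ?cc ?cd ?ca' ?cb' ?cc' ?cd'.
- exists b, d.
  split; first split; rewrite ?ca ?cb ?cc ?cd ?ca' ?cb' ?cc' ?cd' //; first exact: top_bottom.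
  by move=> e; rewrite mem => /or4P[] /eqP->; rewrite ?ca ?cb ?cc ?cd ?ca' ?cb' ?cc' ?cd'.
- exists a, d.
  split; first split; rewrite ?ca ?cb ?cc ?cd ?ca' ?cb' ?cc' ?cd' //;
    first by have := bounds_left (t := t) (tda (l12 isT isT)); rewrite e4; apply.
  by move=> e; rewrite mem => /or4P[] /eqP->; rewrite ?ca ?cb ?cc ?cd ?ca' ?cb' ?cc' ?cd'.
- exists b, a.
  split; first split; rewrite ?ca ?cb ?cc ?cd ?ca' ?cb' ?cc' ?cd' //;
    first exact: (bounds_left (tab (l21 isT isT))) ca' cb.
  by move=> e; rewrite mem => /or4P[] /eqP->; rewrite ?ca ?cb ?cc ?cd ?ca' ?cb' ?cc' ?cd'.
Qed.

End Sweep.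

(** * Disjointness of the inner faces along a vertical line *)

Section NoCrossing.

Variables (R : realType) (G : planar_map) (r : G) (L : G -> nat).
Variables (x y : vertex G -> R).
Hypothesis G34 : angulation34_of_square r.
Hypothesis Lab : GS4_labeling r L.
Hypothesis x_incr : odd_increasing r L x.
Hypothesis y_incr : even_increasing r L y.
Implicit Types (a b c d e u : G) (t : R).

Local Notation next := (face_next G).
Local Notation pos := (fun v : vertex G => (x v, y v)).
Local Notation vec := (vector_of pos).
Local Notation crosses := (vcrosses x).
Local Notation lower := (vlower x y).
Local Notation height := (vheight x y).
Local Notation slope := (vslope x y).
Local Notation bounds := (vbounds x y).
Local Notation swept := (vswept x y).
Local Notation toward := (toward r L).

Definition top_arc := flip G (outer_arc r 3).
Definition bottom_arc := outer_arc r 1.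

Lemma inner_swept t c : inner_corner r c -> swept t (face c).
Proof.
move=> ic; have [d3|d3] := eqVneq (face_degree c) 3.
  by apply: swept_triangle => //; apply: triangle_turn G34 Lab x_incr y_incr _ ic d3.
have d4 : face_degree c = 4.
  by apply/eqP; apply: contraNT d3 => /(degree_neq4 G34 ic)->.
have [c1 c1c q] := quad_corner1_exists Lab ic d4.
rewrite -(face_eq c1c); have [h1 h2] := quad_separated G34 Lab x_incr y_incr q.
by apply: swept_quad => //; case: q.
Qed.

Definition upper_count t b (F : {set G}) := (\sum_(a in F) (crosses t a && lower t b a))%N.
Definition lower_count t b (F : {set G}) :=
  (\sum_(a in F) (crosses t (flip G a) && lower t b (flip G a)))%N.

Lemma swept_counts t b (F : {set G}) u d : u \in F -> d \in F -> crosses t u -> crosses t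
  (flip G d) ->
  swept t F -> [/\ upper_count t b F = lower t b u, lower_count t b F = lower t b (flip G d),
    bounds t (flip G d) u &
    forall a, a \in F -> (crosses t a -> a = u) /\ (crosses t (flip G a) -> a = d)].
Proof.
move=> uF dF cu cd [/(_ u uF)|[u' [d' [[_ _ _ _ bd] uniq]]]]; first by rewrite cu.
have eu : u = u' := (uniq u uF).1 cu; have ed : d = d' := (uniq d dF).2 cd.
rewrite -eu -ed in bd uniq; split=> //.
  rewrite /upper_count (bigD1 u) //= cu big1 ?addn0 // => a /andP[aF au].
  by case: (boolP (crosses t a)) => // /(uniq a aF).1 e; rewrite e eqxx in au.
rewrite /lower_count (bigD1 d) //= cd big1 ?addn0 // => a /andP[aF ad].
by case: (boolP (crosses t (flip G a))) => // /(uniq a aF).2 e; rewrite e eqxx in ad.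
Qed.

Lemma swept_count_le t b (F : {set G}) : swept t F -> (lower_count t b F <= upper_count t b
  F)%N.
Proof.
move=> sw; case: (sw) => [none|[u [d [[uF dF cu cd _] _]]]].
  rewrite /lower_count big1 // => a /none/andP[_ /negbTE->] //.
have [-> -> bd _] := swept_counts b uF dF cu cd sw.
have := bounds_lower cd bd.
case: (boolP (lower t b (flip G d))) => // bl lu.
by rewrite (lower_le_trans _ lu) // not_lowerC.
Qed.

(** For an inner face this is 1 when [b] is below the upper arc but not below the lower arc, and 0
    otherwise: it tests whether [b] runs through the face or along its lower arc. *)
Definition excess t b (F : {set G}) := (upper_count t b F - lower_count t b F)%N.

(** Over all faces, a crossed arc above [b] is counted once in its own face and once, reversed, in
    the face on its other side. Only the terms of the outer face remain. *)
Lemma sum_excess t b :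
  (\sum_(F in porbits next | F != face r) excess t b F + upper_count t b (face r) =
   lower_count t b (face r))%N.
Proof.
have tot : (\sum_a (crosses t a && lower t b a) =
    \sum_a (crosses t (flip G a) && lower t b (flip G a)))%N.
  by rewrite (reindex_inj (@perm_inj _ (flip G))).
rewrite !(sum_porbits next) in tot.
have fr : face r \in porbits next by apply: imset_f.
rewrite (bigD1 _ fr) [RHS](bigD1 _ fr) /= -/(upper_count _ _ _) -/(lower_count _ _ _) in tot.
have inn F : (F \in porbits next) && (F != face r) -> swept t F.
  move=> /andP[/imsetP[c _ ->] cr]; apply: inner_swept.
  by rewrite /inner_corner /outer_corner -eq_porbit_mem.
have -> : (\sum_(F in porbits next | F != face r) excess t b F =
   \sum_(F in porbits next | F != face r) upper_count t b F -
   \sum_(F in porbits next | F != face r) lower_count t b F)%N.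
  by rewrite -sumnB // => F /inn /swept_count_le.
have : (\sum_(F in porbits next | F != face r) lower_count t b F <=
   \sum_(F in porbits next | F != face r) upper_count t b F)%N.
  by apply: leq_sum => F /inn /swept_count_le.
have {}tot : (upper_count t b (face r) +
    \sum_(F in porbits next | F != face r) upper_count t b F = lower_count t b (face r) +
    \sum_(F in porbits next | F != face r) lower_count t b F)%N by [].
lia.
Qed.

Lemma outer_crosses t a : a \in face r ->
  (crosses t a -> a = bottom_arc) /\ (crosses t (flip G a) -> flip G a = top_arc).
Proof.
move=> /(outer_arc_exists G34)[i i14 ->].
have to k := toward_outer L G34 k i14.
have eqx : i = 2 \/ i = 4 -> x (init_vertex (outer_arc r i)) = x (term_vertex (outer_arc r i)).
  by move=> i24; apply: (toward_x_eq x_incr); rewrite to; case: i24 => ->.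
case: i i14 to eqx => [|[|[|[|[|i]]]]] //= _ to eqx; split=> //.
- have /(toward1 x_incr) : toward (outer_arc r 1) 1 by rewrite to.
  by rewrite /crosses term_flip => h /andP[h1 h2]; have := lt_trans h (le_lt_trans h1 h2);
    rewrite ltxx.
- by rewrite /crosses eqx ?[X in _ <= X < _]/=; [case: ltgtP|left].
- by rewrite /crosses term_flip eqx; [case: ltgtP|left].
- have /(toward3 x_incr) : toward (outer_arc r 3) 3 by rewrite to.
  by rewrite /crosses => h /andP[h1 h2]; have := lt_trans h (le_lt_trans h1 h2); rewrite ltxx.
- by rewrite /crosses eqx; [case: ltgtP|right].
- by rewrite /crosses term_flip eqx; [case: ltgtP|right].
Qed.

(** The outer face leaves a total excess of at most 1, from the top arc minus the bottom arc, and
    one face of positive excess uses it up. *)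
Lemma excess_outer t b c : inner_corner r c -> (0 < excess t b (face c))%N ->
  (crosses t top_arc && lower t b top_arc) && ~~ (crosses t bottom_arc && lower t b bottom_arc)
  /\ forall c', inner_corner r c' -> (0 < excess t b (face c'))%N -> face c' = face c.
Proof.
move=> ic ex.
have fr c' : inner_corner r c' -> (face c' \in porbits next) && (face c' != face r).
  by move=> ic'; rewrite imset_f //= eq_porbit_mem.
have low1 : lower_count t b (face r) = (crosses t top_arc && lower t b top_arc).
  rewrite /lower_count (bigD1 (outer_arc r 3)) ?outer_arc_mem //= big1 ?addn0 // => a
    /andP[ar a3].
  case: (boolP (crosses t (flip G a))) => // /(outer_crosses t ar).2 /perm_inj e.
  by rewrite e eqxx in a3.
have up1 : upper_count t b (face r) = (crosses t bottom_arc && lower t b bottom_arc).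
  rewrite /upper_count (bigD1 bottom_arc) ?outer_arc_mem //= big1 ?addn0 // => a /andP[ar a3].
  by case: (boolP (crosses t a)) => // /(outer_crosses t ar).1 e; rewrite e eqxx in a3.
have := sum_excess t b; rewrite low1 up1 (bigD1 (face c)) ?fr //= => tot.
split; first by move: tot ex; do 2!case: (_ && _) => //=; lia.
move=> c' ic' ex'; apply/eqP/negPn/negP => ne.
move: tot; rewrite (bigD1 (face c')) /= ?fr // => tot.
by move: tot ex ex'; do 2!case: (_ && _) => //=; lia.
Qed.

(** The lower arc of the face on the left of [b] is [b] itself, which is not below itself but is
    below the upper arc. *)
Lemma above_excess t b : crosses t b -> inner_corner r (flip G b) ->
  exists u, [/\ u \in face (flip G b), crosses t u, bounds t b u &
    (0 < excess t b (face (flip G b)))%N].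
Proof.
move=> cb ib; have sw := inner_swept t ib.
have fb : flip G b \in face (flip G b) by apply: porbit_id.
have cfb : crosses t (flip G (flip G b)) by rewrite flipK.
case: (sw) => [/(_ _ fb)|[u [d [[uF dF cu cd _] _]]]]; first by rewrite cfb andbF.
have [e1 e2 bd _] := swept_counts b uF fb cu cfb sw.
rewrite flipK in e2 bd.
by exists u; split=> //; rewrite /excess e1 e2 (bounds_lower cb bd) lower_irr.
Qed.

Lemma below_bounds t b : crosses t b -> inner_corner r b ->
  exists d, [/\ d \in face b, crosses t (flip G d) & bounds t (flip G d) b].
Proof.
move=> cb ib; have sw := inner_swept t ib.
have bF : b \in face b by apply: porbit_id.
case: (sw) => [/(_ _ bF)|[u [d [[uF dF cu cd _] _]]]]; first by rewrite cb.
by have [_ _ bd _] := swept_counts b bF dF cb cd sw; exists d.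
Qed.

Lemma not_inner_flip t b : crosses t b -> ~~ inner_corner r (flip G b) -> b = top_arc.
Proof.
rewrite negbK => cb fb; rewrite -(flipK b).
by apply: (outer_crosses t fb).2; rewrite flipK.
Qed.

Lemma not_inner_crosses t b : crosses t b -> ~~ inner_corner r b -> b = bottom_arc.
Proof. by rewrite negbK => cb br; apply: (outer_crosses t br).1. Qed.

Lemma lower_top t b : crosses t b -> b != top_arc -> lower t b top_arc.
Proof.
move=> cb bt; have ib : inner_corner r (flip G b).
  by apply: contraNT bt => /(not_inner_flip cb)/eqP.
have [u [_ _ _ ex]] := above_excess cb ib.
by have [/andP[/andP[]]] := excess_outer ib ex.
Qed.

Lemma lower_bottom t b : crosses t b -> crosses t bottom_arc -> ~~ lower t b bottom_arc.
Proof.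
move=> cb cbot; have [ib|] := boolP (inner_corner r (flip G b)).
  have [u [_ _ _ ex]] := above_excess cb ib.
  by have [/andP[_]] := excess_outer ib ex; rewrite cbot.
move=> /(not_inner_flip cb)->; apply: not_lowerC; apply: lower_top => //.
apply/eqP => e; have := flip_outer_inner G34 (outer_arc_mem r 3).
by rewrite -/top_arc -e outer_arc_mem.
Qed.

(** The parts of the shifted line between the lower and the upper arcs of the inner
    faces are pairwise disjoint. *)
Lemma between_bounds t c u d b : inner_corner r c -> u \in face c -> d \in face c ->
  crosses t u -> crosses t (flip G d) -> crosses t b ->
  ~~ lower t b (flip G d) -> lower t b u -> b = flip G d.
Proof.
move=> ic uF dF cu cd cb bd bu; have sw := inner_swept t ic.
have [e1 e2 _ uniq] := swept_counts b uF dF cu cd sw.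
have ex : (0 < excess t b (face c))%N by rewrite /excess e1 e2 bu (negbTE bd).
have [/andP[/andP[_ ltop] _] same] := excess_outer ic ex.
have ib : inner_corner r (flip G b).
  by apply: contraTT ltop => /(not_inner_flip cb)->; rewrite lower_irr.
have [u' [_ _ _ ex']] := above_excess cb ib.
have fb : flip G b \in face c by rewrite -(same _ ib ex') porbit_id.
by have := (uniq _ fb).2; rewrite flipK => /(_ cb) <-; rewrite flipK.
Qed.

Lemma bounds_height t e u : bounds t e u -> x (init_vertex e) < t \/ x (init_vertex u) < t ->
  height t e < height t u.
Proof. by case=> [[eu s]|//]; rewrite /height eu => -[] h; nra. Qed.

(** Strictly inside [a], the inner faces below and above it have positive height on the line. If [b]
    is lower than [a] after the shift, it runs in the face below, which [between_bounds] excludes;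
    otherwise it falls in the face above, and [between_bounds] identifies it with [a]. *)
Lemma crossing_unique t a b : crosses t a -> x (init_vertex a) < t -> crosses t b ->
  height t a = height t b -> a = b.
Proof.
move=> ca ta cb hab; have [lba|lba] := boolP (lower t b a).
- have [ia|ia] := boolP (inner_corner r a); last first.
    have e := not_inner_crosses ca ia; rewrite e in ca lba.
    by have := lower_bottom cb ca; rewrite lba.
  have [d [dF cd bd]] := below_bounds ca ia.
  have h := bounds_height bd (or_intror ta).
  have e : b = flip G d.
    apply: (between_bounds ia (porbit_id _ a) dF ca cd cb) => //.
    by apply: not_lowerC; rewrite /vlower -hab h.
  by move: h; rewrite hab e ltxx.
- have [ia|ia] := boolP (inner_corner r (flip G a)); last first.
    have e := not_inner_flip ca ia; apply/eqP; rewrite eq_sym; apply: contraNT lba.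
    by rewrite e; apply: lower_top.
  have [u [uF cu bd _]] := above_excess ca ia.
  have h := bounds_height bd (or_introl ta).
  have := between_bounds ia uF (porbit_id _ _) cu _ cb; rewrite flipK => -> //.
  by rewrite /vlower -hab h.
Qed.

(** * Extremal vertices and the bounding rectangle *)

Lemma exists_toward a (i : nat) : (exists2 b, init_vertex b = init_vertex a & toward b i) \/
  exists2 k, (0 < k <= 4)%N /\ init_vertex a = sq_vertex r k &
    (k == i + 2 %[mod 4])%N || (k == i + 3 %[mod 4])%N.
Proof.
have [/existsP[c /andP[ca cr]]|] := boolP [exists c in porbit (cw G) a, c \in face r];
  last first.
  rewrite negb_exists => /forallP no; left;
    apply: (inner_vertex_toward G34 Lab) => c /init_vertexP ca.
  by have := no c; rewrite ca.
have ea : init_vertex a = init_vertex c by apply/esym/init_vertexP.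
have [k k4 ck] := outer_arc_exists G34 cr; rewrite ea ck.
(* At v_k an outer arc starts in direction [k], and the reverse of the outer arc that ends there
   points toward [k - 1]. *)
have [ik|ik] := boolP (i == k %[mod 4])%N.
  by left; exists (outer_arc r k) => //; rewrite toward_outer.
have [ik1|ik1] := boolP (k == i + 1 %[mod 4])%N; last first.
  right; exists k => //; move: ik ik1; lia.
left; pose k' := (if k == 4 then 1 else k.+1)%N.
have k'4 : (0 < k' <= 4)%N by move: k4; rewrite /k'; case: eqP => //; lia.
exists (flip G (outer_arc r k')).
  rewrite -/(term_vertex _) -init_face_next outer_arc_pred // /k'.
  by move: k4; move: (k) => [|[|[|[|[|]]]]].
rewrite toward_flip toward_outer //; move: ik1; rewrite /k'; have [->|_] := eqVneq k 4; lia.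
Qed.

(** A leftmost vertex has no arc toward the left, so it is v_1 or v_2, which have equal abscissas;
    the right side is symmetric with v_3 and v_4. *)
Lemma x_bounds v : x (sq_vertex r 1) <= x v <= x (sq_vertex r 4).
Proof.
have [a ->] := vertex_init v; apply/andP; split.
  have [m _ mP] := arg_minP (fun b => x (init_vertex b)) (isT : xpredT a).
  apply: le_trans (mP a isT).
  have [[b bm /(toward3 x_incr)]|[k [k4 ->]]] := exists_toward m 3.
    by rewrite bm => h; have := mP (flip G b) isT; rewrite -/(term_vertex b) leNgt h.
  move: k4; case: k => [|[|[|[|[|k]]]]] //= _ _.
  have to := toward_outer L G34.
  have := @toward_x_eq _ _ _ L _ x_incr (outer_arc r 2); rewrite !to // => /(_ erefl erefl) e.
  rewrite /sq_vertex e -init_face_next outer_arc_pred //.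
have [m _ mP] := arg_maxP (fun b => x (init_vertex b)) (isT : xpredT a).
apply: (le_trans (mP a isT)).
have [[b bm /(toward1 x_incr)]|[k [k4 ->]]] := exists_toward m 1.
  by rewrite bm => h; have := mP (flip G b) isT; rewrite -/(term_vertex b) /= leNgt h.
move: k4; case: k => [|[|[|[|[|k]]]]] //= _ _.
have to := toward_outer L G34.
have := @toward_x_eq _ _ _ L _ x_incr (outer_arc r 4); rewrite !to // => /(_ erefl erefl) e.
by rewrite /sq_vertex e -init_face_next outer_arc_pred.
Qed.

Lemma y_bounds v : y (sq_vertex r 1) <= y v <= y (sq_vertex r 2).
Proof.
have [a ->] := vertex_init v; apply/andP; split.
  have [m _ mP] := arg_minP (fun b => y (init_vertex b)) (isT : xpredT a).
  apply: le_trans (mP a isT).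
  have [[b bm /(toward2 y_incr)]|[k [k4 ->]]] := exists_toward m 2.
    by rewrite bm => h; have := mP (flip G b) isT; rewrite -/(term_vertex b) leNgt h.
  move: k4; case: k => [|[|[|[|[|k]]]]] //= _ _.
  have to := toward_outer L G34.
  have := @toward_y_eq _ _ _ L _ y_incr (outer_arc r 1); rewrite !to // => /(_ erefl erefl) e.
  by rewrite /sq_vertex e -init_face_next outer_arc_pred.
have [m _ mP] := arg_maxP (fun b => y (init_vertex b)) (isT : xpredT a).
apply: (le_trans (mP a isT)).
have [[b bm /(toward0 y_incr)]|[k [k4 ->]]] := exists_toward m 0.
  by rewrite bm => h; have := mP (flip G b) isT; rewrite -/(term_vertex b) /= leNgt h.
move: k4; case: k => [|[|[|[|[|k]]]]] //= _ _.
have to := toward_outer L G34.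
have := @toward_y_eq _ _ _ L _ y_incr (outer_arc r 3); rewrite !to // => /(_ erefl erefl) e.
by rewrite /sq_vertex e -init_face_next outer_arc_pred.
Qed.

Lemma x34 : x (sq_vertex r 3) = x (sq_vertex r 4).
Proof.
have to := toward_outer L G34.
have := @toward_x_eq _ _ _ L _ x_incr (outer_arc r 4); rewrite !to // => /(_ erefl erefl) e.
by rewrite /sq_vertex e -init_face_next outer_arc_pred.
Qed.

Lemma right_arc v : (exists2 b, init_vertex b = v & 0 < (vec b).1) \/
  (v = sq_vertex r 3 \/ v = sq_vertex r 4).
Proof.
have [a ->] := vertex_init v.
have [[b bv /(toward1 x_incr) tb]|[k [k4 ->]]] := exists_toward a 1.
  by left; exists b; rewrite // subr_gt0.
by move: k4; case: k => [|[|[|[|[|k]]]]] //= _ _; right; [left|right].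
Qed.

(** * Vertical edges *)

Definition upward_vertical a := ((vec a).1 == 0) && (0 < (vec a).2).

Lemma standard_direction a : exists a', (a' == a) || (a' == flip G a) /\
  (0 < (vec a').1) || upward_vertical a'.
Proof.
have [i ti] : exists i, toward a i.
  have [ia|] := boolP (inner_corner r a); first by exists (L a + 3)%N; apply: toward_right.
  rewrite negbK => ar; exists ((L (flip G a) + 3) + 2)%N.
  by rewrite -toward_flip; apply: (toward_right G34 Lab); apply: flip_outer_inner.
have pos_i := dir_coord_toward x_incr y_incr ti.
have [h|h|h] := ltgtP (vec a).1 0.
- by exists (flip G a); rewrite eqxx orbT vec_flip /= oppr_gt0 h.
- by exists a; rewrite eqxx h.
have [h2|h2|h2] := ltgtP (vec a).2 0.
- exists (flip G a); rewrite eqxx orbT; split=> //; apply/orP; right.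
  rewrite /upward_vertical vec_flip; move: h h2 => /= -> h2.
  by rewrite oppr0 eqxx oppr_gt0.
- by exists a; rewrite eqxx; split=> //; apply/orP; right; rewrite /upward_vertical h eqxx.
by move: pos_i; rewrite /dir_coord; case: (i %% 4)%N => [|[|[|_]]]; rewrite ?h ?h2 ?oppr0 ltxx.
Qed.

Lemma vec_right_crosses b : 0 < (vec b).1 -> crosses (x (init_vertex b)) b.
Proof. by rewrite subr_gt0 /vcrosses lexx. Qed.

Lemma height_init b : height (x (init_vertex b)) b = y (init_vertex b).
Proof. by rewrite /vheight subrr mul0r addr0. Qed.

(** Pointing only upward forces the label 1 at the start of [a]. A jump of 2 would make it point
    right as well, so the next label is 2 and the next arc goes right. The arc before goes left,
    whether its label is 4, or 3 with a jump of 2. *)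
Lemma vertical_face a : inner_corner r a -> upward_vertical a ->
  0 < (vec (next a)).1 /\ exists2 d, next d = a & 0 < (vec (flip G d)).1.
Proof.
move=> ia /andP[/eqP a1 a2].
have x0 : x (term_vertex a) = x (init_vertex a) by move: a1 => /= /eqP;
  rewrite subr_eq0 => /eqP.
have nt1 : toward a 1 = false by apply/negP => /(toward1 x_incr); rewrite x0 ltxx.
have nt3 : toward a 3 = false by apply/negP => /(toward3 x_incr); rewrite x0 ltxx.
have nt2 : toward a 2 = false.
  by apply/negP => /(toward2 y_incr); move: a2 => /=; rewrite subr_gt0 => /lt_trans/[apply];
    rewrite ltxx.
have la : L a = 1%N.
  have := toward_right G34 Lab ia; have := label_range Lab ia.
  rewrite (toward_mod _ _ _ (esym (modn_mod _ 4))).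
  by case: (L a) => [|[|[|[|[|l]]]]] //; rewrite /= ?nt1 ?nt2 ?nt3.
have next_label c : inner_corner r c -> L c = 1%N -> toward c 1 = false -> L (next c) = 2%N.
  move=> ic lc t1; have inc : inner_corner r (next c) by rewrite inner_face_next.
  have := label_range Lab inc; have := GS4_L2 Lab ic.
  have [d3|d3] := eqVneq (face_degree c) 3.
    have := triangle_jump_le2 Lab ic d3; have := toward_triangle_jump2 G34 Lab ic d3.
    by rewrite lc t1; case: (L (next c)) => [|[|[|[|[|l]]]]] // /(_ erefl).
  have := quad_jump Lab ic; rewrite lc; case: G34 => _ _ /(_ _ ic) [e|->].
    by rewrite e eqxx in d3.
  by move=> /(_ erefl); case: (L (next c)) => [|[|[|[|[|l]]]]].
have ina : inner_corner r (next a) by rewrite inner_face_next.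
split.
  have := toward_right G34 Lab ina; rewrite next_label //.
  by rewrite (toward_mod _ _ _ (_ : _ = 1 %[mod 4])) // => /(toward1 x_incr); rewrite subr_gt0.
pose d := flip G (cw G a); have nd : next d = a by apply: face_next_flip_cw.
exists d => //; have id : inner_corner r d by rewrite -inner_face_next nd.
have t3 : toward d 3.
  have := toward_right G34 Lab id; have := label_range Lab id; have := GS4_L2 Lab id.
  rewrite nd la; have [d3|d3] := eqVneq (face_degree d) 3.
    have := triangle_jump_le2 Lab id d3; have := toward_triangle_jump2 G34 Lab id d3.
    by rewrite nd la; case: (L d) => [|[|[|[|[|l]]]]] // /(_ erefl).
  have := quad_jump Lab id; rewrite nd la; case: G34 => _ _ /(_ _ id) [e|->].
    by rewrite e eqxx in d3.
  move=> /(_ erefl) j _ l4; have -> : L d = 4%N by move: j l4; rewrite /jump; lia.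
  by rewrite (toward_mod _ _ _ (_ : _ = 3 %[mod 4])).
by rewrite vec_flip /= oppr_gt0 subr_lt0; apply: toward3 x_incr _ t3.
Qed.

Lemma right_crosses_max b : 0 < (vec b).1 -> x (init_vertex b) < x (sq_vertex r 4).
Proof.
rewrite subr_gt0 => /lt_le_trans; apply.
by have /andP[] := x_bounds (term_vertex b).
Qed.

Lemma upward_vertical_outer a : upward_vertical a -> ~~ inner_corner r a ->
  a = outer_arc r 4.
Proof.
move=> /andP[/eqP a1 a2]; rewrite negbK => /(outer_arc_exists G34)[k k4 e].
have to := toward_outer L G34 _ k4; move: a1 a2; rewrite e.
case: k k4 {e} to => [|[|[|[|[|k]]]]] //= _ to a1 a2.
- by have := @toward1 _ _ _ _ _ x_incr (outer_arc r 1);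
  rewrite to -subr_gt0 a1 ltxx => /(_ isT).
- have := @toward2 _ _ _ _ _ y_incr (outer_arc r 2); rewrite to -subr_lt0 => /(_ isT).
  by move=> /(lt_trans a2); rewrite ltxx.
- by have := @toward3 _ _ _ _ _ x_incr (outer_arc r 3);
  rewrite to -subr_lt0 a1 ltxx => /(_ isT).
Qed.

Lemma vertical_x a : upward_vertical a -> x (term_vertex a) = x (init_vertex a).
Proof. by move=> /andP[/eqP/= /eqP + _]; rewrite subr_eq0 => /eqP. Qed.

Lemma vertical_y a : upward_vertical a -> y (init_vertex a) < y (term_vertex a).
Proof. by move=> /andP[_]; rewrite subr_gt0. Qed.

Lemma vertical_arcs a : inner_corner r a -> upward_vertical a ->
  exists e u, [/\ crosses (x (init_vertex a)) e, crosses (x (init_vertex a)) u,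
    height (x (init_vertex a)) e = y (init_vertex a),
    height (x (init_vertex a)) u = y (term_vertex a) &
    [/\ u \in face a, flip G e \in face a & next (flip G e) = a]].
Proof.
move=> ia va; have [u1 [d nd d1]] := vertical_face ia va; have vx := vertical_x va.
have di : init_vertex (flip G d) = init_vertex a by rewrite -nd init_face_next.
exists (flip G d), (next a).
split; first by rewrite -di; apply: vec_right_crosses.
- by rewrite -vx -init_face_next; apply: vec_right_crosses.
- by rewrite -di height_init.
- by rewrite -vx -init_face_next height_init.
by rewrite flipK mem_face_next porbit_id -mem_face_next nd porbit_id.
Qed.

(** Just to the right of [a], an inner face is bounded by arcs that leave the two ends of [a], and
    [between_bounds] applies to it. On the right side of the outer rectangle nothing is crossed. *)
Lemma vertical_not_crossed a b : upward_vertical a -> crosses (x (init_vertex a)) b ->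
  y (init_vertex a) < height (x (init_vertex a)) b -> height (x (init_vertex a)) b < y
    (term_vertex a) ->
  False.
Proof.
move=> va cb h1 h2; have [ia|ia] := boolP (inner_corner r a).
  have [e [u [ce cu he hu [uF dF nd]]]] := vertical_arcs ia va.
  have := between_bounds (d := flip G e) (b := b) ia uF dF cu; rewrite flipK => /(_ ce cb) be.
  have eb : b = e by apply: be; [apply: not_lowerC|]; rewrite /vlower ?he ?hu ?h1 ?h2.
  by move: h1; rewrite eb he ltxx.
have := upward_vertical_outer va ia => ea.
have := right_crosses_max (crosses_dx y cb); case/andP: cb => h3 h4 h5.
have /andP[_] := x_bounds (term_vertex b); rewrite leNgt => /negP; apply.
by apply: le_lt_trans h4; rewrite ea.
Qed.

(** The lower ends have equal heights, since otherwise the arc that leaves the higher one to the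
    right would cross the other edge. Then the lower arcs of the two right faces coincide, and each
    determines the vertical arc that follows it on the contour. *)
Lemma vertical_unique a b p : upward_vertical a -> upward_vertical b ->
  x (init_vertex a) = x (init_vertex b) ->
  y (init_vertex a) < p < y (term_vertex a) -> y (init_vertex b) < p < y (term_vertex b) ->
  a = b.
Proof.
move=> va vb xab /andP[a1 a2] /andP[b1 b2].
have boundary c u : upward_vertical c -> ~~ inner_corner r c ->
    ~~ crosses (x (init_vertex c)) u.
  move=> vc /(upward_vertical_outer vc)->; apply/negP => /andP[_].
  by rewrite ltNge; have /andP[_ ->] := x_bounds (term_vertex u).
have [ia|ia] := boolP (inner_corner r a); have [ib|ib] := boolP (inner_corner r b).
- have [e [u [ce cu he hu [uF dF nd]]]] := vertical_arcs ia va.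
  have [e' [u' [ce' cu' he' hu' [uF' dF' nd']]]] := vertical_arcs ib vb.
  have yle c c' e2 : upward_vertical c -> crosses (x (init_vertex c)) e2 ->
      height (x (init_vertex c)) e2 = y (init_vertex c') -> y (init_vertex c') < p ->
      p < y (term_vertex c) -> y (init_vertex c') <= y (init_vertex c).
    move=> vc c2 h2 p1 p2; rewrite leNgt; apply/negP => h3.
    by apply: (vertical_not_crossed vc c2); rewrite h2 // (lt_trans p1).
  have yab : y (init_vertex a) = y (init_vertex b).
    apply/eqP; rewrite eq_le (yle b a e) -?xab // (yle a b e') ?xab //.
  have [l|l] := boolP (lower (x (init_vertex a)) e' e).
    have := between_bounds (d := flip G e') (b := e) ib uF' dF' cu'.
    rewrite flipK -xab => /(_ _ ce (not_lowerC l)) ee'.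
    by rewrite -nd -nd' ee' ?xab // /vlower -xab he xab hu' yab (lt_trans b1).
  have := between_bounds (d := flip G e) (b := e') ia uF dF cu.
  rewrite flipK => /(_ ce _ l) ee'.
  by rewrite -nd -nd' ee' ?xab // /vlower he' -xab hu -yab (lt_trans a1).
- have [e [u [ce _ _ _ _]]] := vertical_arcs ia va.
  by have := boundary b e vb ib; rewrite -xab ce.
- have [e [u [ce _ _ _ _]]] := vertical_arcs ib vb.
  by have := boundary a e va ia; rewrite xab ce.
by rewrite (upward_vertical_outer va ia) (upward_vertical_outer vb ib).
Qed.

(** * Positions of vertices and edges in the plane *)

Lemma open_segment_flip a p : open_segment (pos (init_vertex a)) (pos (term_vertex a)) p ->
  open_segment (pos (init_vertex (flip G a))) (pos (term_vertex (flip G a))) p.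
Proof.
rewrite term_flip => -[t /andP[t0 t1] ->]; exists (1 - t); first by apply/andP; split; lra.
by rewrite -/(term_vertex a); congr (_, _) => /=; ring.
Qed.

Lemma open_segment_right a p : 0 < (vec a).1 ->
  open_segment (pos (init_vertex a)) (pos (term_vertex a)) p ->
  [/\ crosses p.1 a, x (init_vertex a) < p.1 & height p.1 a = p.2].
Proof.
move=> a0 [t /andP[t0 t1] ->]; have := vec_slope a0; move: (a0).
rewrite /vcrosses /vheight /=; move: (slope a) => s; move: (y (term_vertex a)) => yt a0' ys.
have -> : yt = y (init_vertex a) + s * (x (term_vertex a) - x (init_vertex a)) by lra.
split; last by ring.
- by apply/andP; split; nra.
- by nra.
Qed.

Lemma open_segment_vertical a p : upward_vertical a ->
  open_segment (pos (init_vertex a)) (pos (term_vertex a)) p ->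
  p.1 = x (init_vertex a) /\ y (init_vertex a) < p.2 < y (term_vertex a).
Proof.
move=> va [t /andP[t0 t1] ->] /=; rewrite (vertical_x va); have := vertical_y va => h.
by split; [ring|apply/andP; split; nra].
Qed.

(** Turning counterclockwise around [init_vertex b] from [b], the last arc not above
    [b'] bounds from below the face in which [b'] starts. *)
Lemma coincident_init_le b b' : 0 < (vec b).1 -> 0 < (vec b').1 ->
  x (init_vertex b) = x (init_vertex b') -> y (init_vertex b) = y (init_vertex b') ->
  slope b <= slope b' -> init_vertex b = init_vertex b'.
Proof.
move=> b0 b0' xe ye sb; set t := x (init_vertex b').
pose P c := [&& init_vertex c == init_vertex b, 0 < (vec c).1 & slope c <= slope b'].
have Pb : P b by rewrite /P eqxx b0 sb.
have [m /and3P[/eqP mb m0 sm] mP] := arg_maxP slope Pb.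
have cb' : crosses t b' by apply: vec_right_crosses.
have cm : crosses t m by rewrite /t -xe -mb; apply: vec_right_crosses.
have hm : height t m = y (init_vertex b') by rewrite /t -xe -mb height_init mb.
have hb' : height t b' = y (init_vertex b') by apply: height_init.
have nl : ~~ lower t b' m by rewrite /vlower hm hb' ltxx eqxx /= -leNgt.
rewrite -mb; suff -> : b' = m by [].
have [im|/(not_inner_flip cm) e] := boolP (inner_corner r (flip G m)); last first.
  by apply/eqP; apply: contraNT nl; rewrite e; apply: lower_top.
have [u [uF cu bd _]] := above_excess cm im.
have [lu|lu] := boolP (lower t b' u).
  have := between_bounds (d := flip G m) (b := b') im uF (porbit_id _ _) cu.
  by rewrite flipK; apply.
case: bd => [[mu su]|hu]; last by rewrite /vlower hb' -hm hu in lu.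
have Pu : P u.
  rewrite /P -mu mb eqxx (crosses_dx _ cu) /=.
  have hu : height t u = y (init_vertex b') by rewrite /t -xe -mb mu height_init -mu mb.
  by move: lu; rewrite /vlower hb' hu ltxx eqxx /= -leNgt.
by have := mP u Pu; rewrite /= leNgt su.
Qed.

Lemma sq34_lt : y (sq_vertex r 4) < y (sq_vertex r 3).
Proof.
have := @toward0 _ _ _ _ _ y_incr (outer_arc r 4).
by rewrite toward_outer // -init_face_next outer_arc_pred // => /(_ isT).
Qed.

Lemma right_boundary_alone v w : v = sq_vertex r 3 \/ v = sq_vertex r 4 ->
  x v = x w -> y v = y w -> v = w.
Proof.
move=> v34 xe ye; have xv : x w = x (sq_vertex r 4) by rewrite -xe; case: v34 => ->;
  rewrite ?x34.
have [[b bw b0]|w34] := right_arc w.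
  by have := right_crosses_max b0; rewrite bw xv ltxx.
case: v34 w34 ye {xe xv} => -> [] -> //; move: sq34_lt => h e; by rewrite e ltxx in h.
Qed.

Lemma injective_positions : injective pos.
Proof.
move=> v w [xe ye].
have [[b bv b0]|v34] := right_arc v; last exact: right_boundary_alone.
have [[b' bw b0']|w34] := right_arc w; last by apply/esym/right_boundary_alone.
move: xe ye; rewrite -bv -bw => xe ye.
by have [h|/ltW h] := leP (slope b) (slope b'); [|apply/esym]; apply: coincident_init_le.
Qed.

(** An arc that leaves [v] to the right is crossed at the position of [v]. A non-vertical edge
    through [v] would equal it by [crossing_unique], although it starts strictly further left;
    [vertical_not_crossed] treats a vertical edge. The vertices v_3 and v_4, without such an arc,
    are handled by the bounding rectangle. *)
Lemma vertex_not_on_edge v a : ~ open_segment (pos (init_vertex a)) (pos (term_vertex a))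
  (pos v).
Proof.
move=> va; have [a' [a'E a'dir]] := standard_direction a.
have {}va : open_segment (pos (init_vertex a')) (pos (term_vertex a')) (pos v).
  by case/orP: a'E => /eqP->; [|apply: open_segment_flip].
case/orP: a'dir => [a0|av].
  have [/= ca ta ha] := open_segment_right a0 va.
  have [[b bv b0]|v34] := right_arc v.
    rewrite -bv in ca ta ha.
    have e := crossing_unique ca ta (vec_right_crosses b0).
    by rewrite e ?ltxx ?height_init // in ta.
  have xv : x v = x (sq_vertex r 4) by case: v34 => ->; rewrite ?x34.
  case/andP: ca => _; have /andP[_] := x_bounds (term_vertex a').
  by rewrite xv => /le_lt_trans/[apply]; rewrite ltxx.
have [/= xv /andP[y1 y2]] := open_segment_vertical av va.
have [[b bv b0]|v34] := right_arc v.
  rewrite -bv in xv y1 y2.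
  apply: (vertical_not_crossed av (b := b)); rewrite -xv ?height_init //.
  exact: vec_right_crosses.
have {}xv : x (init_vertex a') = x (sq_vertex r 4) by rewrite -xv; case: v34 => ->;
  rewrite ?x34.
have [ia|ia] := boolP (inner_corner r a').
  have [u0 _] := vertical_face ia av; have := right_crosses_max u0.
  by rewrite init_face_next (vertical_x av) xv ltxx.
move: y1 y2; rewrite (upward_vertical_outer av ia) -init_face_next outer_arc_pred //.
by case: v34 => ->; rewrite ?ltxx.
Qed.

Lemma edges_disjoint a b p : b != a -> b != flip G a ->
  open_segment (pos (init_vertex a)) (pos (term_vertex a)) p ->
  open_segment (pos (init_vertex b)) (pos (term_vertex b)) p -> False.
Proof.
move=> ba bfa pa pb; have [a' [a'E a'dir]] := standard_direction a.
have [b' [b'E b'dir]] := standard_direction b.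
have {}pa : open_segment (pos (init_vertex a')) (pos (term_vertex a')) p.
  by case/orP: a'E => /eqP->; [|apply: open_segment_flip].
have {}pb : open_segment (pos (init_vertex b')) (pos (term_vertex b')) p.
  by case/orP: b'E => /eqP->; [|apply: open_segment_flip].
suff e : a' = b'.
  move: ba bfa b'E; rewrite -e; case/orP: a'E => /eqP->.
    by rewrite (eq_sym a b) => /negbTE-> +;
      rewrite -(inj_eq (@perm_inj _ (flip G))) flipK (eq_sym _ a) => /negbTE ->.
  by rewrite (eq_sym (flip G a)) => + /negbTE->;
    rewrite (inj_eq (@perm_inj _ (flip G))) eq_sym => /negbTE->.
case/orP: a'dir => [a0|av]; case/orP: b'dir => [b0|bv].
- have [ca ta ha] := open_segment_right a0 pa; have [cb tb hb] := open_segment_right b0 pb.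
  by apply: crossing_unique ca ta cb _; rewrite ha hb.
- have [ca ta ha] := open_segment_right a0 pa.
  have [xb /andP[y1 y2]] := open_segment_vertical bv pb.
  by case: (vertical_not_crossed bv (b := a')); rewrite -xb ?ha.
- have [cb tb hb] := open_segment_right b0 pb.
  have [xa /andP[y1 y2]] := open_segment_vertical av pa.
  by case: (vertical_not_crossed av (b := b')); rewrite -xa ?hb.
have [xa ya] := open_segment_vertical av pa; have [xb yb] := open_segment_vertical bv pb.
by apply: vertical_unique av bv _ ya yb; rewrite -xa.
Qed.

End NoCrossing.

(** * Rotation around the vertices *)

Section Sectors.

Variable R : realType.
Implicit Types (u v w : R * R) (t d : nat).

(** The plane minus the origin is cut into 8 sectors, in clockwise order: the open
    half-axes (even numbers, starting with the upward one) and the open quadrants. *)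
Definition sector t u : bool :=
  (0 < dir_coord t./2 u) &&
  (if odd t then 0 < dir_coord t./2.+1 u else dir_coord t./2.+1 u == 0).

Lemma dir_coord_mod i j u : i = j %[mod 4] -> dir_coord i u = dir_coord j u.
Proof. by rewrite /dir_coord => ->. Qed.

Lemma sector_mod t t' u : t = t' %[mod 8] -> sector t u = sector t' u.
Proof.
move=> e; rewrite /sector.
have -> : odd t = odd t' by lia.
rewrite (@dir_coord_mod t./2 t'./2); last by lia.
by rewrite (@dir_coord_mod t./2.+1 t'./2.+1) //; lia.
Qed.

Lemma dir_coord_opp2 i u : dir_coord i.+2 u = - dir_coord i u.
Proof. by rewrite -addn2 dir_coord_opp. Qed.

Lemma sector_opp t u : sector (t + 4) u = sector t (- u.1, - u.2).
Proof.
have opp i : dir_coord i (- u.1, - u.2) = - dir_coord i u.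
  by rewrite /dir_coord; case: (i %% 4)%N => [|[|[|]]].
rewrite /sector !opp -!dir_coord_opp2 oddD addbF.
by have -> : (t + 4)./2 = t./2.+2 by lia.
Qed.

(** For these gaps the clockwise angle is strictly between 0 and pi. *)
Lemma sector_cross t d u v : sector t u -> sector (t + d) v -> (0 < d < 4)%N ->
  cross u v < 0.
Proof.
rewrite /sector (crossE t./2) => /andP[u0 u1] /andP[v0 v1].
case: d v0 v1 => [|[|[|[|d]]]] // + + _; rewrite ?addn1 ?addn2 ?addn3 /= ?negbK.
- rewrite uphalf_half; case: (odd t) u1 => /= u1 v0 v1.
    by rewrite add1n in v0 v1; rewrite dir_coord_opp2 oppr_eq0 in v1; nra.
  by rewrite add0n in v0 v1; rewrite (eqP u1); nra.
- case: (odd t) u1 => /= u1 v0; rewrite dir_coord_opp2 => v1.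
    by nra.
  by rewrite oppr_eq0 in v1; rewrite (eqP u1) (eqP v1); nra.
- rewrite uphalf_half; case: (odd t) u1 => /= u1 v0 v1.
    by rewrite ?add1n dir_coord_opp2 in v0; rewrite ?add1n !dir_coord_opp2 oppr_eq0 in v1;
      rewrite (eqP v1); nra.
  by rewrite ?add0n in v0; rewrite ?add0n dir_coord_opp2 in v1; rewrite (eqP u1); nra.
Qed.

Lemma sector_odd_pos t u : odd t -> sector t u ->
  0 < dir_coord t./2 u /\ 0 < dir_coord t./2.+1 u.
Proof. by rewrite /sector => -> /andP[]. Qed.

Lemma cross_trans t u v w : odd t -> sector t u -> sector t v -> sector t w ->
  cross u v <= 0 -> cross v w <= 0 -> cross u w <= 0.
Proof.
move=> o /(sector_odd_pos o)[u0 u1] /(sector_odd_pos o)[v0 v1] /(sector_odd_pos o)[w0 w1].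
rewrite !(crossE t./2) => h1 h2; rewrite -(pmulr_lle0 _ v0).
move: (dir_coord t./2 u) (dir_coord t./2 v) (dir_coord t./2 w) u0 v0 w0 h1 h2.
move: (dir_coord _ u) (dir_coord _ v) (dir_coord _ w) u1 v1 w1 => u1 v1 w1 U1 V1 W1 u0 v0 w0
  U0 V0 W0 h1 h2.
have -> : (u1 * w0 - u0 * w1) * v0 = (u1 * v0 - u0 * v1) * w0 + (v1 * w0 - v0 * w1) * u0 by
  ring.
by nra.
Qed.

Lemma cross_trans_lt t u v w : odd t -> sector t u -> sector t v -> sector t w ->
  cross u v < 0 -> cross v w < 0 -> cross u w < 0.
Proof.
move=> o /(sector_odd_pos o)[u0 u1] /(sector_odd_pos o)[v0 v1] /(sector_odd_pos o)[w0 w1].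
rewrite !(crossE t./2) => h1 h2; rewrite -(pmulr_llt0 _ v0).
move: (dir_coord t./2 u) (dir_coord t./2 v) (dir_coord t./2 w) u0 v0 w0 h1 h2.
move: (dir_coord _ u) (dir_coord _ v) (dir_coord _ w) u1 v1 w1 => u1 v1 w1 U1 V1 W1 u0 v0 w0
  U0 V0 W0 h1 h2.
have -> : (u1 * w0 - u0 * w1) * v0 = (u1 * v0 - u0 * v1) * w0 + (v1 * w0 - v0 * w1) * u0 by
  ring.
by nra.
Qed.

Lemma crossC u v : cross v u = - cross u v.
Proof. by rewrite /cross; ring. Qed.

(** If [w] precedes [u] in a quadrant and [v] is in the opposite quadrant, then not
    both clockwise angles from [u] to [v] and from [v] to [w] are at least pi. *)
Lemma sector_opposite t u v w : odd t -> sector t u -> sector (t + 4) v -> sector t w ->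
  cross w u < 0 -> (cross u v < 0) || (cross v w < 0).
Proof.
move=> o su; rewrite sector_opp => sv sw h.
rewrite -[_ || _]negbK negb_or -!leNgt; apply/negP => /andP[h1 h2].
have : cross u w <= 0.
  by apply: (cross_trans o su sv sw); move: h1 h2; rewrite /cross /=; lra.
by rewrite crossC; lra.
Qed.

(** At least two of the gaps are below 4 unless they are 0, 4 and 4 in some order. Then two of the
    vectors share a quadrant and the third is in the opposite one, as in [sector_opposite]. *)
Lemma clockwise_sectors t d1 d2 d3 u v w :
  sector t u -> sector (t + d1) v -> sector (t + d1 + d2) w -> (d1 + d2 + d3)%N = 8 ->
  (d1 = 0%N -> odd t /\ cross u v < 0) ->
  (d2 = 0%N -> odd (t + d1) /\ cross v w < 0) ->
  (d3 = 0%N -> odd (t + d1 + d2) /\ cross w u < 0) -> clockwise u v w.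
Proof.
move=> su sv sw d8 c1 c2 c3.
have s8 : sector (t + d1 + d2 + d3) u by rewrite (sector_mod _ (_ : _ = t %[mod 8])) //; lia.
have small d p q k : sector k p -> sector (k + d) q -> (d = 0%N -> odd k /\ cross p q < 0) ->
    (d < 4)%N -> cross p q < 0.
  by move=> sp sq; case: (posnP d) => [-> /(_ erefl)[]|d0 _ d4] //;
    apply: sector_cross sp sq _; rewrite d0.
have s1 := small _ _ _ _ su sv c1; have s2 := small _ _ _ _ sv sw c2.
have s3 := small _ _ _ _ sw s8 c3.
rewrite /clockwise.
have [/s1 h1|l1] := ltnP d1 4; have [/s2 h2|l2] := ltnP d2 4; have [/s3 h3|l3] := ltnP d3 4.
all: try by rewrite h1 h2.
all: try by rewrite h2 h3 orbT.
all: try by rewrite h1 h3 !orbT.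
- have [e1 e2 e3] : [/\ d1 = 0, d2 = 4 & d3 = 4]%N by move: d8 l2 l3; clear=> *; split; lia.
  move: sv sw; rewrite e1 e2 addn0 => sv sw; have [o h] := c1 e1.
  by have := sector_opposite o sv sw su h; rewrite h !andbT /= => /orP[]->; rewrite ?orbT.
- have [e1 e2 e3] : [/\ d1 = 4, d2 = 0 & d3 = 4]%N by move: d8 l1 l3; clear=> *; split; lia.
  move: sv sw s8; rewrite e1 e2 e3 addn0 => sv sw s8; have [] := c2 e2; rewrite e1 => o h.
  by have := sector_opposite o sw s8 sv h; rewrite h !andbT /= => /orP[]->; rewrite ?orbT.
- have [e1 e2 e3] : [/\ d1 = 4, d2 = 4 & d3 = 0]%N by move: d8 l1 l2; clear=> *; split; lia.
  move: sv sw s8; rewrite e1 e2 e3 addn0 => sv sw s8; have [_ h] := c3 e3.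
  have [o _] := c3 e3; have {}o : odd t by move: o; rewrite e1 e2 !oddD !addbF.
  have {}sw : sector t w by rewrite (sector_mod _ (_ : _ = (t + 4 + 4)%N %[mod 8])) // -addnA
    modnDr.
  by have := sector_opposite o su sv sw h; rewrite h !andbT /= => /orP[]->; rewrite ?orbT.
by move: d8 l1 l2 l3; clear=> *; lia.
Qed.

End Sectors.

Section Rotation.

Variables (R : realType) (G : planar_map) (r : G) (L : G -> nat).
Variables (x y : vertex G -> R).
Hypothesis G34 : angulation34_of_square r.
Hypothesis Lab : GS4_labeling r L.
Hypothesis x_incr : odd_increasing r L x.
Hypothesis y_incr : even_increasing r L y.
Implicit Types (a b c : G).

Local Notation next := (face_next G).
Local Notation vec := (vector_of (fun v : vertex G => (x v, y v))).
Local Notation toward := (toward r L).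

Definition arc_sector a : nat :=
  if toward a 0 then (if toward a 1 then 1 else if toward a 3 then 7 else 0)
  else if toward a 1 then (if toward a 2 then 3 else 2)
  else if toward a 2 then (if toward a 3 then 5 else 4) else 6.

(** Position of [a] relative to the axis of direction [l + 3]: an eighth of a turn before it (0), on
    it (1), or an eighth past it (2). *)
Definition spread a l : nat := 1 + toward a l - toward a (l + 2).

Lemma arc_sectorE a l : toward a (l + 3) -> toward a (l + 1) = false ->
  ~~ (toward a l && toward a (l + 2)) -> arc_sector a = (2 * l + 5 + spread a l)%N %[mod 8].
Proof.
have red k : toward a (l + k) = toward a (l %% 4 + k) by apply: toward_mod; rewrite modnDml.
have red0 : toward a l = toward a (l %% 4) by apply: toward_mod; rewrite modn_mod.
rewrite /spread !red red0 => t3 t1 t02.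
rewrite (_ : (_ + _)%N = (2 * (l %% 4) + 5 + (1 + toward a (l %% 4) - toward a (l %% 4 +
  2)))%N %[mod 8]);
  last by move: (1 + _ - _)%N => k; lia.
have := ltn_pmod l (isT : (0 < 4)%N); move: t3 t1 t02; rewrite /arc_sector.
have t4 : toward a 4 = toward a 0 by [].
have t5 : toward a 5 = toward a 1 by [].
have t6 : toward a 6 = toward a 2 by [].
case: (l %% 4)%N => [|[|[|[|]]]] //=; rewrite ?add0n ?add1n /= ?t4 ?t5 ?t6 => t3 t1 + _;
  rewrite ?t3 ?t1; by do 2!case: (toward a _).
Qed.

Lemma arc_sector_right c : inner_corner r c ->
  arc_sector c = (2 * L c + 5 + spread c (L c))%N %[mod 8].
Proof.
by move=> ic; apply: arc_sectorE;
  [apply: toward_right|apply: toward_right_opp|apply: toward_right_adj].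
Qed.

Lemma arc_sector_left a : inner_corner r (flip G a) ->
  arc_sector a = (2 * L (next (flip G a)) + 7 + spread a (L (next (flip G a))).+1)%N %[mod 8].
Proof.
move=> ia; set l := L _; have t0 := toward_left G34 Lab ia;
  have t2 := toward_left_opp G34 Lab ia.
have t13 := toward_left_adj G34 Lab ia; rewrite -/l in t0 t2 t13.
rewrite (@arc_sectorE a l.+1).
- by move: (spread _ _) => k; lia.
- by rewrite (toward_mod _ _ _ (_ : _ = l %[mod 4])) //; lia.
- by rewrite addn1 -addn2.
- by rewrite addn2.
Qed.

Lemma sector_vec a l : toward a (l + 3) -> toward a (l + 1) = false ->
  ~~ (toward a l && toward a (l + 2)) -> sector (2 * l + 5 + spread a l) (vec a).
Proof.
move=> t3 t1; rewrite /spread.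
have c3 : 0 < dir_coord (l + 3) (vec a) := dir_coord_toward x_incr y_incr t3.
have c4 : dir_coord (l + 3).+1 (vec a) = dir_coord l (vec a).
  by apply: dir_coord_mod; lia.
case: (boolP (toward a l)) => [t0|/negbTE t0];
  case: (boolP (toward a (l + 2))) => [t2|/negbTE t2] // _.
- have c0 := dir_coord_toward x_incr y_incr t0.
  rewrite /sector (_ : _./2 = l + 3)%N; last lia.
  by rewrite c3 c4 c0 ifT //; lia.
- have c2 := dir_coord_toward x_incr y_incr t2.
  rewrite /sector (_ : _./2 = l + 2)%N; last lia.
  by rewrite c2 -addnS c3 ifT //; lia.
- rewrite /sector (_ : _./2 = l + 3)%N; last lia.
  rewrite c3 c4 ifF; last lia.
  have h0 : 0 <= dir_coord l (vec a) by apply: dir_coord_ge0 x_incr y_incr _ _ t2.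
  have h2 : 0 <= dir_coord (l + 2) (vec a).
    apply: dir_coord_ge0 x_incr y_incr _ _ _.
    by rewrite (toward_mod _ _ _ (_ : _ = l %[mod 4])) //; lia.
  by rewrite dir_coord_opp in h2; rewrite eq_le h0 /= -oppr_ge0 h2.
Qed.

Lemma sectorP a : sector (arc_sector a) (vec a).
Proof.
have [ia|] := boolP (inner_corner r a).
  rewrite (sector_mod _ (arc_sector_right ia)); apply: sector_vec.
  - exact: toward_right.
  - exact: toward_right_opp.
  - exact: toward_right_adj.
rewrite negbK => ar; have [k k4 ->] := outer_arc_exists G34 ar.
have to j := toward_outer L G34 j k4.
(* This arc points in direction [k] only, so [k.+1] plays the role of the label on its right. *)
have t3 : toward (outer_arc r k) (k.+1 + 3) by rewrite to; lia.
have t1 : toward (outer_arc r k) (k.+1 + 1) = false by rewrite to; lia.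
have t02 : ~~ (toward (outer_arc r k) k.+1 && toward (outer_arc r k) (k.+1 + 2)).
  by rewrite !to; lia.
by rewrite (sector_mod _ (arc_sectorE t3 t1 t02)); apply: sector_vec.
Qed.

Definition step c : nat := (arc_sector (cw G c) + 8 - arc_sector c) %% 8.

Lemma arc_sector_lt a : (arc_sector a < 8)%N.
Proof. by rewrite /arc_sector; do !case: ifP. Qed.

Lemma spread_le2 a l : (spread a l <= 2)%N.
Proof. by rewrite /spread; case: (toward a l); case: (toward a (l + 2)). Qed.

(** The sectors of both arcs around the corner are expressed through [L c]. As spreads are at most
    2, the relation holds without reduction modulo 8. *)
Lemma step_inner c : inner_corner r c ->
  (step c + spread c (L c) = 2 + spread (cw G c) (L c).+1)%N.
Proof.
move=> ic; have := arc_sector_right ic.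
have := @arc_sector_left (cw G c); rewrite -inner_face_next face_next_flip_cw => /(_ ic).
have := spread_le2 c (L c); have := spread_le2 (cw G c) (L c).+1.
have := arc_sector_lt c; have := arc_sector_lt (cw G c); rewrite /step; lia.
Qed.

(** Over the whole tour, the sums of the steps and of twice the jumps satisfy the same relation with
    the right and left spreads, so they agree, and L1 gives 8. *)
Lemma sum_step_inner a : inner_vertex r (init_vertex a) ->
  (\sum_(c in porbit (cw G) a) step c = 8)%N.
Proof.
move=> iv; have inn c : c \in porbit (cw G) a -> inner_corner r c by move/init_vertexP;
  apply: iv.
have inn' c : c \in porbit (cw G) a -> inner_corner r (flip G c).
  by move=> ca; rewrite -inner_face_next face_next_flip inn // -mem_porbit_step permKV.
pose left c := spread c (L (next (flip G c))).+1.
have s1 : (\sum_(c in porbit (cw G) a) step c + \sum_(c in porbit (cw G) a) spread c (L c) =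
   \sum_(c in porbit (cw G) a) 2 + \sum_(c in porbit (cw G) a) left c)%N.
  have -> : (\sum_(c in porbit (cw G) a) left c = \sum_(c in porbit (cw G) a) left (cw G c))%N.
    rewrite (reindex_inj (@perm_inj _ (cw G))) /=.
    by apply: eq_bigl => c; rewrite mem_porbit_step.
  rewrite -!big_split /=; apply: eq_bigr => c ca.
  by rewrite step_inner ?inn // /left face_next_flip_cw.
have s2 : (\sum_(c in porbit (cw G) a) 2 * jump (L (next (flip G c))) (L c) +
    \sum_(c in porbit (cw G) a) spread c (L c) =
   \sum_(c in porbit (cw G) a) 2 + \sum_(c in porbit (cw G) a) left c)%N.
  rewrite -!big_split /=; apply: eq_bigr => c ca.
  have ia : inner_arc r c by rewrite inner_arcE inn ?inn'.
  have /andP[_ /eqP] := jump_inner_arc G34 Lab ia.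
  by rewrite /left /spread !addn2.
have s3 : (\sum_(c in porbit (cw G) a) 2 * jump (L (next (flip G c))) (L c) = 8)%N.
  rewrite (reindex_inj (@perm_inj _ (cw G))) /= (eq_bigl [in porbit (cw G) a]).
    rewrite -big_distrr /= (eq_bigr (fun c => jump (L c) (L (cw G c)))).
      by rewrite (GS4_L1_vertex Lab iv).
    by move=> c _; rewrite face_next_flip_cw.
  by move=> c; rewrite mem_porbit_step.
lia.
Qed.

Lemma outer_toward c0 : c0 \in face r -> exists2 k, (0 < k <= 4)%N &
  [/\ c0 = outer_arc r k, forall j, toward c0 j = (j == k %[mod 4])%N &
      forall j, toward (cw G c0) j = (j + 1 == k %[mod 4])%N].
Proof.
move=> c0r; have [k k4 c0E] := outer_arc_exists G34 c0r.
exists k => //; split=> // [|j]; first by rewrite c0E => j; apply: toward_outer.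
pose f := cw G c0; have fr : flip G f \in face r.
  by rewrite -mem_face_next face_next_flip_cw.
have [k' k'4 fE] := outer_arc_exists G34 fr.
have kk' : (k' == k + 1 %[mod 4])%N.
  have := toward_outer L G34 k k4; rewrite -c0E.
  have := outer_arc_pred G34 k'4; rewrite -fE face_next_flip_cw => -> /esym.
  have h : (0 < (if k' == 1 then 4 else k'.-1) <= 4)%N.
    by move: k'4; case: (k') => [|[|[|[|[|]]]]].
  rewrite (toward_outer L G34 k h) eqxx.
  by move: k4 k'4; clear; case: k => [|[|[|[|[|]]]]] //; case: k' => [|[|[|[|[|]]]]].
by rewrite -/f -(flipK f) toward_flip fE toward_outer //; move: kk'; clear; lia.
Qed.

(** Clockwise from direction [k] to direction [k - 1] there are three quarters of a turn. *)
Lemma step_outer c0 : c0 \in face r -> step c0 = 6%N.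
Proof.
move=> c0r; have [k k4 [_ tc0 tf]] := outer_toward c0r.
have := @arc_sectorE c0 k.+1; have := @arc_sectorE (cw G c0) k.
have := arc_sector_lt c0; have := arc_sector_lt (cw G c0).
rewrite /step /spread !tc0 !tf; move: (arc_sector _) (arc_sector _) k4 => s s'; clear.
by case: k => [|[|[|[|[|]]]]] // _ lts lts' /(_ isT erefl isT) h /(_ isT erefl isT) h'; lia.
Qed.

(** All inner labels at v_k are [k], so no label jumps across an inner arc, which puts these arcs in
    the open quadrant between the directions [k - 1] and [k]. The tour takes 6 eighths over the
    outer corner, one to enter the quadrant and one to leave it. *)
Lemma sum_step_outer a c0 : c0 \in face r -> init_vertex c0 = init_vertex a ->
  (\sum_(c in porbit (cw G) a) step c = 8)%N.
Proof.
move=> c0r c0a; have [k k4 [c0E tc0 tf]] := outer_toward c0r.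
have c0in : c0 \in porbit (cw G) a by apply/init_vertexP.
pose f := cw G c0; rewrite -/f in tf; have fr : flip G f \in face r.
  by rewrite -mem_face_next face_next_flip_cw.
have fin : f \in porbit (cw G) a by rewrite mem_porbit_step.
have fi : f \notin face r by have := flip_outer_inner G34 fr; rewrite flipK.
have neq : f != c0 by apply: contraNneq fi => ->.
have label c : c \in porbit (cw G) a -> c != c0 -> inner_corner r c /\ L c = k.
  move=> /init_vertexP ca cc0; have ic : inner_corner r c.
    apply: contraNT cc0; rewrite negbK => cr; apply/eqP.
    by case: G34 => _ inj _; apply: inj => //; rewrite ca.
  by split=> //; apply: (GS4_L0 Lab) => //; rewrite ca -c0a c0E.
have spread_left c : c \in porbit (cw G) a -> c != f -> spread c k.+1 = (c == c0) /\
    (c != c0 -> spread c k = 2%N).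
  move=> ca cf; have [->|cc0] := eqVneq c c0.
    by rewrite /spread !tc0; split=> //; move: k4; clear; case: k => [|[|[|[|[|]]]]].
  have [ic lc] := label c ca cc0; pose p := (cw G)^-1%g c.
  have pc : cw G p = c by rewrite permKV.
  have pin : p \in porbit (cw G) a by rewrite -mem_porbit_step pc.
  have pc0 : p != c0 by apply: contraNneq cf => e; rewrite /f -e pc.
  have [ip lp] := label p pin pc0.
  have ifc : inner_corner r (flip G c) by rewrite -inner_face_next face_next_flip.
  have ia : inner_arc r c by rewrite inner_arcE ic ifc.
  have /andP[_ /eqP] := jump_inner_arc G34 Lab ia.
  rewrite face_next_flip -/p lp lc (_ : jump k k = 0%N) => [|];
    last by rewrite /jump addnC addnK.
  have := spread_le2 c k; have := spread_le2 c k.+1; rewrite /spread !addn2.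
  move: (1 + _ - _)%N (1 + _ - _)%N => m n; clear; lia.
have stepE c : c \in porbit (cw G) a ->
    step c = (6 * (c == c0) + (c == f) + (cw G c == c0))%N.
  move=> ca; have [->|cc0] := eqVneq c c0.
    by rewrite -/f eq_sym (negbTE neq) step_outer.
  have [ic lc] := label c ca cc0; have := step_inner ic; rewrite lc.
  have cwa : cw G c \in porbit (cw G) a by rewrite mem_porbit_step.
  have cwf : cw G c != f by rewrite (inj_eq perm_inj).
  have [-> _] := spread_left _ cwa cwf.
  have [->|cf] := eqVneq c f.
    have -> : spread f k = 1%N by rewrite /spread !tf; move: k4; clear;
      case: k => [|[|[|[|[|]]]]].
    by move: (step f) (cw G f == c0) => m n; clear; lia.
  have [_ /(_ cc0)->] := spread_left _ ca cf.
  by move: (step c) (cw G c == c0) => m n; clear; lia.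
rewrite (eq_bigr _ stepE) 2!big_split.
have -> : (\sum_(c in porbit (cw G) a) 6 * (c == c0) = 6 * \sum_(c in porbit (cw G) a) (c ==
  c0))%N.
  by rewrite big_distrr.
have one d : d \in porbit (cw G) a -> (\sum_(c in porbit (cw G) a) (c == d) = 1)%N.
  by move=> da; rewrite (bigD1 d) //= eqxx big1 ?addn0 // => c /andP[_ /negbTE->].
rewrite !one //.
rewrite (eq_bigr (fun c => nat_of_bool (c == (cw G)^-1%g c0))); last first.
  by move=> c _; rewrite -(inj_eq (@perm_inj _ (cw G)) c) permKV.
by rewrite one // -mem_porbit_step permKV.
Qed.

Lemma sum_step a : (\sum_(c in porbit (cw G) a) step c = 8)%N.
Proof.
have [/existsP[c /andP[ca cr]]|] := boolP [exists c in porbit (cw G) a, c \in face r].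
  by apply: sum_step_outer cr _; apply/init_vertexP.
rewrite negb_exists => /forallP no; apply: sum_step_inner => c /init_vertexP ca.
by have := no c; rewrite ca.
Qed.

(** A zero step forces spreads 2 and 0, hence an open quadrant. The cross product is then that of
    the turn of the face at this corner: a triangle turns clockwise, and in a quadrangle the
    directions found make the corner the leftmost or the rightmost vertex. *)
Lemma step_eq0 c : step c = 0%N -> odd (arc_sector c) /\ cross (vec c) (vec (cw G c)) < 0.
Proof.
move=> s0; have ic : inner_corner r c by rewrite /inner_corner; apply/negP => /step_outer;
  rewrite s0.
set l := L c; have := step_inner ic; rewrite s0 -/l add0n => sp.
have [sp2 sp0] : spread c l = 2%N /\ spread (cw G c) l.+1 = 0%N.
  by have := spread_le2 c l; move: sp; clear; move: (spread _ _) (spread _ _) => m n; split;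
    lia.
have tc : toward c l by move: sp2; rewrite /spread; case: (toward c l); case: (toward c _).
have tcw : toward (cw G c) (l + 3).
  have -> : (l + 3 = l.+1 + 2)%N by rewrite addn3 addn2.
  by move: sp0; rewrite /spread; case: (toward _ l.+1); case: (toward _ (l.+1 + 2)).
split; first by have := arc_sector_right ic; rewrite -/l sp2; clear; lia.
have turn p : next p = c -> cross (vec p) (vec c) < 0 -> cross (vec c) (vec (cw G c)) < 0.
  move=> pc; rewrite -pc cw_face_next pc vec_flip /cross /=; lra.
have prev p : next p = c -> cw G c = flip G p by move=> <-; rewrite cw_face_next.
have [d3|d3] := eqVneq (face_degree c) 3.
  have e := triangle_face_next3 d3; apply: (turn (next (next c)) e); rewrite -{2}e.
  apply: (triangle_turn G34 Lab x_incr y_incr).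
    by rewrite !inner_face_next.
  by rewrite !degree_face_next.
have d4 : face_degree c = 4%N by apply/eqP; apply: contraNT d3 => /(degree_neq4 G34 ic)->.
have [c1 c1c q] := quad_corner1_exists Lab ic d4.
have [hx hy] := quad_separated G34 Lab x_incr y_incr q.
have [l2 l3 l4] := quad_labels Lab q; have [_ d1 l1] := q.
have [t1 t2 t3 t4] := quad_turns d1 hx hy.
have e4 := quad_face_next4 d1.
have : c \in face c1 by rewrite (face_eq c1c) porbit_id.
rewrite face_mem d1 /= !inE => /or4P[] /eqP cE; rewrite /l in tc tcw.
- rewrite cE l1 in tc; have {}tc := toward1 x_incr tc.
  apply: (turn (next (next (next c1)))); rewrite cE //; apply: t1.
  by rewrite -init_face_next in tc.
- have lc : L c = 2%N by rewrite cE.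
  rewrite lc (prev _ (esym cE)) in tcw; apply: (turn _ (esym cE)); rewrite cE; apply: t2.
  by have := toward1 x_incr (tcw : toward _ 1);
    rewrite term_flip -/(term_vertex c1) -init_face_next.
- rewrite cE l3 in tc; have {}tc := toward3 x_incr tc.
  apply: (turn _ (esym cE)); rewrite cE; apply: t3.
  by rewrite -init_face_next in tc.
have lc : L c = 4%N by rewrite cE.
rewrite lc (prev _ (esym cE)) in tcw; apply: (turn _ (esym cE)); rewrite cE; apply: t4.
by have := toward3 x_incr (tcw : toward _ 3);
  rewrite term_flip -/(term_vertex _) -init_face_next.
Qed.

(** The sector of the [n]th arc after [a] in clockwise order, counted from that of
    [a] without reducing modulo 8. *)
Definition turned a n : nat := arc_sector a + \sum_(i < n) step (iter i (cw G) a).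

Lemma turnedS a n : turned a n.+1 = (turned a n + step (iter n (cw G) a))%N.
Proof. by rewrite /turned big_ord_recr addnA. Qed.

Lemma turned_mod a n : turned a n = arc_sector (iter n (cw G) a) %[mod 8].
Proof.
elim: n => [|n IH]; first by rewrite /turned big_ord0 addn0.
rewrite turnedS /step iterS -modnDml IH; move: (iter n _ a) => b.
have := arc_sector_lt b; have := arc_sector_lt (cw G b).
by move: (arc_sector _) (arc_sector _); clear; lia.
Qed.

Lemma turned_sector a n : sector (turned a n) (vec (iter n (cw G) a)).
Proof. by rewrite (sector_mod _ (turned_mod a n)) sectorP. Qed.

Lemma turned_le a m n : (m <= n)%N -> (turned a m <= turned a n)%N.
Proof.
move=> /subnK <-; elim: (n - m)%N => // k IH.
by rewrite addSn turnedS (leq_trans IH) // leq_addr.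
Qed.

(** All steps in between vanish, and strict clockwise order composes within an open quadrant. *)
Lemma turned_eq a m n : (m < n)%N -> turned a m = turned a n ->
  odd (turned a m) /\ cross (vec (iter m (cw G) a)) (vec (iter n (cw G) a)) < 0.
Proof.
elim: n => // n IH; rewrite ltnS leq_eqVlt => /predU1P[-> | mn] e.
  move: e; rewrite turnedS => /esym /eqP; rewrite -{2}[turned a n]addn0 eqn_add2l => /eqP s0.
  have [o h] := step_eq0 s0; split=> //.
  by have := turned_mod a n; move: o; clear; lia.
have emn : turned a m = turned a n.
  by apply/eqP; rewrite eqn_leq turned_le ?(ltnW mn) //= e turned_le.
have [o h] := IH mn emn; split=> //.
have s0 : step (iter n (cw G) a) = 0%N by move: e; rewrite turnedS -emn; clear; lia.
have [_ h'] := step_eq0 s0; apply: cross_trans_lt o _ _ _ h h'; first exact: turned_sector.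
  by rewrite emn turned_sector.
by rewrite e -iterS turned_sector.
Qed.

Lemma turned_order a : turned a #|porbit (cw G) a| = (turned a 0 + 8)%N.
Proof.
rewrite /turned big_ord0 addn0; congr (_ + _)%N.
rewrite -(sum_step a) -(big_mkord xpredT (fun i => step (iter i (cw G) a))).
rewrite [RHS](eq_bigl _ _ (porbit_traject (cw G) a)) -big_uniq ?uniq_traject_porbit //.
rewrite (big_nth a) size_traject; apply: eq_big_nat => i /andP[_ ilt].
by rewrite nth_traject.
Qed.

Lemma arcs_clockwise a b : init_vertex b = init_vertex a -> b != a -> b != cw G a ->
  clockwise (vec a) (vec (cw G a)) (vec b).
Proof.
move=> /init_vertexP; rewrite porbit_traject => /trajectP[j jn ->] ba bca.
have j1 : (1 < j)%N by case: j ba bca {jn} => [|[|j]] //; rewrite eqxx.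
have := turned_order a; set n := #|_| in jn *; move=> tn.
have le1 := turned_le a (isT : (0 <= 1)%N); have le2 := turned_le a (ltnW j1).
have le3 := turned_le a (ltnW jn); rewrite tn in le3.
have e1 : (turned a 0 + (turned a 1 - turned a 0) = turned a 1)%N by rewrite subnKC.
have e2 : (turned a 1 + (turned a j - turned a 1) = turned a j)%N by rewrite subnKC.
(* The gaps from [a] to [cw G a], to [b] and back to [a] make one turn. [turned_eq] settles a zero
   gap, the last one with the index [n] that leads back to [a]. *)
apply: (@clockwise_sectors _ (turned a 0) (turned a 1 - turned a 0) (turned a j - turned a 1)
  (turned a 0 + 8 - turned a j)).
- exact: (turned_sector a 0).
- by rewrite e1; exact: (turned_sector a 1).
- by rewrite e1 e2; exact: turned_sector.
- by move: le1 le2 le3; clear; lia.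
- move=> d0; apply: (@turned_eq a 0 1) => //.
  by move: d0 le1; clear; lia.
- rewrite e1 => d0; apply: (@turned_eq a 1 j) => //.
  by move: d0 le2; clear; lia.
- rewrite e1 e2 => d0; have := @turned_eq a j n jn; rewrite tn /n iter_porbit.
  by apply; move: d0 le3; clear; lia.
Qed.

End Rotation.

Import numFieldNormedType.Exports.
(** * Outer face *)

Section OuterFace.

Local Open Scope classical_set_scope.

Lemma affine_continuous (R : realType) (p d : R * R) :
  continuous (fun s : R => (p.1 + s * d.1, p.2 + s * d.2) : R * R).
Proof.
move=> s.
have affine (q c : R) : (q + t * c) @[t --> s] --> q + s * c.
  by apply: cvgD; [exact: cvg_cst|apply: cvgM; [exact: cvg_id|exact: cvg_cst]].
exact: cvg_pair (affine _ _) (affine _ _).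
Qed.

(** A ray is connected, so it lies in the component of its origin, and it leaves every ball. *)
Lemma unbounded_ray_component (R : realType) (A : set (R * R)) (p d : R * R) (e : R) :
  d != 0 -> (forall s, e <= s -> A (p.1 + s * d.1, p.2 + s * d.2)) ->
  ~ bounded_set (connected_component A (p.1 + e * d.1, p.2 + e * d.2)).
Proof.
move=> d0 ray [M0 [_ bound]].
pose f s : R * R := (p.1 + s * d.1, p.2 + s * d.2).
have conn : connected (f @` `[e, +oo[).
  apply: connected_continuous_connected.
    by apply/connected_intervalP; exact: interval_is_interval.
  exact/continuous_subspaceT/affine_continuous.
have sub : f @` `[e, +oo[ `<=` connected_component A (f e).
  apply: connected_component_max => //; first by exists e; rewrite //= in_itv /= lexx.
  by move=> _ [s /= + <-]; rewrite in_itv /= andbT; apply: ray.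
have norm_le s : e <= s -> `|p.1 + s * d.1| <= M0 + 1 /\ `|p.2 + s * d.2| <= M0 + 1.
  move=> es; have fs : connected_component A (f e) (f s).
    by apply: sub; exists s; rewrite //= in_itv /= es.
  have := bound (M0 + 1) (ltr_pwDr ltr01 (lexx _)) _ fs.
  by rewrite /= prodnormedzmodule.ProdNormedZmodule.prod_normE ge_max => /andP[].
have escape (q c : R) : c != 0 -> exists2 s, e <= s & M0 + 1 < `|q + s * c|.
  (* Far enough for [s * c] to exceed [q] in absolute value by more than [M0 + 1], and at least [e]
     to stay on the ray. *)
  move=> c0; pose s := Num.max e ((`|M0 + 1| + `|q| + 1) / `|c|).
  exists s; first by rewrite /s le_max lexx.
  have cpos : 0 < `|c| by rewrite normr_gt0.
  have hs : `|M0 + 1| + `|q| + 1 <= s * `|c| by rewrite -ler_pdivrMr // /s le_max lexx orbT.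
  have h1 : s * `|c| <= `|s * c| by rewrite normrM ler_wpM2r // ler_norm.
  have h2 : `|s * c| - `|q| <= `|q + s * c|.
    by rewrite lerBlDl addrC -{1}(addKr q (s * c)) (le_trans (ler_normD _ _)) // normrN addrC.
  by have := ler_norm (M0 + 1); lra.
have [d1|d1] := eqVneq d.1 0.
  have d2 : d.2 != 0 by apply: contra_neq d0 => d2; rewrite [d]surjective_pairing d1 d2.
  have [s es] := escape p.2 _ d2.
  by have [_] := norm_le s es; rewrite leNgt => /negP.
have [s es] := escape p.1 _ d1.
by have [+ _] := norm_le s es; rewrite leNgt => /negP.
Qed.

Variables (R : realType) (G : planar_map) (r : G) (L : G -> nat).
Variables (x y : vertex G -> R).
Hypothesis G34 : angulation34_of_square r.
Hypothesis Lab : GS4_labeling r L.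
Hypothesis x_incr : odd_increasing r L x.
Hypothesis y_incr : even_increasing r L y.

Local Notation pos := (fun v : vertex G => (x v, y v)).
Local Notation vec := (vector_of pos).

Lemma segment_bounds (m M s p q : R) : m <= p <= M -> m <= q <= M -> 0 <= s <= 1 ->
  m <= (1 - s) * p + s * q <= M.
Proof. by move=> /andP[? ?] /andP[? ?] /andP[? ?]; apply/andP; split; nra. Qed.

Lemma support_bounds p : drawing_support pos p ->
  x (sq_vertex r 1) <= p.1 <= x (sq_vertex r 4) /\ y (sq_vertex r 1) <= p.2 <= y (sq_vertex r
    2).
Proof.
move=> [a _ [s s01 ->]] /=.
have bx := x_bounds G34 Lab x_incr; have by_ := y_bounds G34 Lab y_incr.
by split; apply: segment_bounds.
Qed.

(** The drawing stays in the rectangle of the outer vertices, which the right normal of an outer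
    side leaves at once. *)
Lemma right_of_outer a e : a \in face r -> 0 < e -> ~ drawing_support pos (right_of pos a e).
Proof.
move=> /(outer_arc_exists G34)[k k4 ->] e0 /support_bounds[].
rewrite /right_of /=.
have bx := x_bounds G34 Lab x_incr; have by_ := y_bounds G34 Lab y_incr.
have to := toward_outer L G34 _ k4.
have v := outer_arc_pred G34 k4; rewrite -!init_face_next v -!/(sq_vertex r _).
have eqx : k = 2%N \/ k = 4%N -> x (init_vertex (outer_arc r k)) = x (term_vertex (outer_arc
  r k)).
  by move=> k24; apply: (toward_x_eq x_incr); rewrite to; case: k24 => ->.
have eqy : k = 1%N \/ k = 3%N -> y (init_vertex (outer_arc r k)) = y (term_vertex (outer_arc
  r k)).
  by move=> k13; apply: (toward_y_eq y_incr); rewrite to; case: k13 => ->.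
rewrite -!init_face_next v -!/(sq_vertex r _) in eqx eqy.
have d0 := @toward0 _ _ _ _ _ y_incr (outer_arc r k);
  have d1 := @toward1 _ _ _ _ _ x_incr (outer_arc r k).
have d2 := @toward2 _ _ _ _ _ y_incr (outer_arc r k);
  have d3 := @toward3 _ _ _ _ _ x_incr (outer_arc r k).
rewrite to -init_face_next v -!/(sq_vertex r _) in d0;
  rewrite to -init_face_next v -!/(sq_vertex r _) in d1.
rewrite to -init_face_next v -!/(sq_vertex r _) in d2;
  rewrite to -init_face_next v -!/(sq_vertex r _) in d3.
move: (by_ (sq_vertex r 3)) (bx (sq_vertex r 3)) (bx (sq_vertex r 2)) (by_ (sq_vertex r 4)).
case: k k4 {to v} eqx eqy d0 d1 d2 d3 => [|[|[|[|[|k]]]]] //= _ eqx eqy d0 d1 d2 d3.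
- have h1 := d1 isT; have h2 := eqy (or_introl erefl).
  by move=> _ _ _ _ _ /andP[+ _]; nra.
- have h1 := d2 isT; have h2 := eqx (or_introl erefl).
  by move=> _ _ _ _ /andP[+ _] _; nra.
- have h1 := d3 isT; have h2 := eqy (or_intror erefl).
  by move=> _ _ _ _ _ /andP[_ +]; nra.
- have h1 := d0 isT; have h2 := eqx (or_intror erefl).
  by move=> _ _ _ _ /andP[_ +] _; nra.
Qed.

Lemma outer_face_unbounded a : outer_corner r a -> \forall e \near 0^'+,
  ~ bounded_set (connected_component (~` drawing_support pos) (right_of pos a e)).
Proof.
move=> ar; near=> e; have e0 : 0 < e by [].
pose p := (((x (init_vertex a) + x (term_vertex a)) / 2,
  (y (init_vertex a) + y (term_vertex a)) / 2) : R * R).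
pose d := ((vec a).2, - (vec a).1) : R * R.
have pd s : right_of pos a s = (p.1 + s * d.1, p.2 + s * d.2).
  by rewrite /right_of /p /d /= mulrN.
rewrite pd; apply: unbounded_ray_component => [|s es]; last first.
  by rewrite -pd; apply: right_of_outer => //; apply: lt_le_trans es.
(* The normal is nonzero because the arc has a positive component in the direction it points. *)
have [k k4 ak] := outer_arc_exists G34 ar.
have to : toward r L a k by rewrite ak toward_outer.
have := dir_coord_toward x_incr y_incr to.
apply: contraTneq; rewrite /d => -[h1 /eqP]; rewrite oppr_eq0 => /eqP h2.
by rewrite /dir_coord; case: (k %% 4)%N => [|[|[|_]]]; rewrite /= ?h1 ?h2 ?oppr0 ltxx.
Unshelve. all: by end_near.
Qed.

End OuterFace.

Theorem theorem3p3 (R : realType) (G : planar_map) (r : G) (L : G -> nat)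
    (ho he : vertex G -> R) :
  angulation34_of_square r ->
  adapted G ->
  GS4_labeling r L ->
  odd_increasing r L ho ->
  even_increasing r L he ->
  planar_straight_line_drawing r (fun v => (ho v, he v)).
Proof.
move=> G34 _ Lab x_incr y_incr; split.
- exact: injective_positions G34 Lab x_incr y_incr.
- exact: vertex_not_on_edge G34 Lab x_incr y_incr.
- move=> a b ba bfa; rewrite -subset0 => p [pa pb].
  exact: edges_disjoint G34 Lab x_incr y_incr _ _ _ ba bfa pa pb.
- exact: arcs_clockwise G34 Lab x_incr y_incr.
- exact: outer_face_unbounded G34 Lab x_incr y_incr.
Qed.
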